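(* Let $X\subset(\mathbb{C}^* )^n$ be a torically non-singular and torically projective hypersurface. Then the (extended) logarithmic Gauss map $\overline{\gamma}_X:\overline X\to\mathbb{C}P^{n-1}$ is finite, i.e. $\overline{\gamma}_X^{-1}(y)$ is a finite set for every $y\in\mathbb{C}P^{n-1}$.
   Context: Let $X\subset(\mathbb{C}^* )^n$ be an algebraic hypersurface defined by a polynomial equation $P(z_1,\ldots,z_n)=0$. $\Delta(X)\subset\mathbb{R}^n$ denotes the Newton polytope of $P$ (well defined up to translation in $\mathbb{Z}^n$), $\mathrm{Tor}(X)$ the complex toric variety defined by $\Delta(X)$, and $\overline X$ the topological closure of $X$ in $\mathrm{Tor}(X)$. $X$ is torically non-singular if $\Delta(X)$ is $n$-dimensional and the intersection of $\overline X$ with each torus orbit of $\mathrm{Tor}(X)$ is non-singular in this orbit. $X$ is torically projective if $\mathrm{Tor}(X)=\mathbb{C}P^n$. The logarithmic Gauss map of a non-singular hypersurface $X\subset(\mathbb{C}^* )^n$ is $\gamma_X:X\to\mathbb{C}P^{n-1}$, $(z_1,\ldots,z_n)\mapsto[z_1\frac{\partial P}{\partial z_1}(z):\cdots:z_n\frac{\partial P}{\partial z_n}(z)]$. When $X$ is torically non-singular, $\gamma_X$ extends to an algebraic map $\overline{\gamma}_X:\overline X\to\mathbb{C}P^{n-1}$ (a known fact). *)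

(* Defs.v *)
From HB Require Import structures.
(* The notations of mpoly clash with those of the analysis library. *)
From mathcomp Require mpoly.
Import -(notations) mpoly.
From mathcomp Require Import all_boot all_order all_algebra.
From mathcomp Require Import all_classical all_reals all_analysis.
From mathcomp Require Import complex.

Set Implicit Arguments.
Unset Strict Implicit.
Unset Printing Implicit Defensive.

Import Order.TTheory GRing.Theory Num.Theory.
Import numFieldNormedType.Exports.

Local Open Scope classical_set_scope.
Local Open Scope ring_scope.
Local Open Scope quotient_scope.

(* Naming the numClosedFieldType makes the topology of the modulus available. *)
Definition cplx (R : realType) : numClosedFieldType := R[i].

(** Spaces with functions.  [O p g] means that [g] is regular in some Zariski
    neighbourhood of [p]; outside that neighbourhood [g] is arbitrary. *)
Definition germs (C V : Type) := V -> (V -> C) -> Prop.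

Definition restrict_germs (C V : Type) (O : germs C V) (Y : set V) :
    germs C Y :=
  fun p g => exists2 G, O (set_val p) G & forall q : Y, g q = G (set_val q).

(* Continuity for the Zariski topologies is implied: if [g] is 0 on an open
   neighbourhood of [f p] and 1 elsewhere, then [g \o f] is regular at [p], so
   it vanishes on a neighbourhood of [p]. *)
Definition algebraic_map (C V W : Type) (OV : germs C V) (OW : germs C W)
    (f : V -> W) :=
  forall (p : V) (g : W -> C), OW (f p) g -> OV p (g \o f).

Section ProjectiveSpace.
Context {R : realType}.
Local Notation C := (cplx R).

(* CP^(m-1), as the set of lines of C^m *)
Definition proj_space (m : nat) := {L : {vspace 'rV[C]_m} | \dim L == 1%N}.

(* homogeneous coordinates of [L] *)
Definition proj_coord m (L : proj_space m) : 'rV[C]_m := vpick (val L).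

Definition proj_germs m : germs C (proj_space m) :=
  fun L g => exists (d : nat) (a b : mpoly m C),
    [/\ a \is ishomog1 d mdeg, b \is ishomog1 d mdeg,
        meval (proj_coord L 0) b != 0
      & forall L', meval (proj_coord L' 0) b != 0 ->
          g L' = meval (proj_coord L' 0) a / meval (proj_coord L' 0) b].

End ProjectiveSpace.

Section Toric.
Context {R : realType} {n : nat}.
Local Notation C := (cplx R).
Local Notation lattice := 'rV[int]_n.

Definition torus : set 'rV[C]_n := [set z | forall i, z 0 i != 0].

Definition torus_mul (z w : 'rV[C]_n) : 'rV[C]_n := map2_mx *%R z w.

Definition monomial (z : 'rV[C]_n) (m : lattice) : C := \prod_i z 0 i ^ m 0 i.

Lemma monomial0 z : monomial z 0 = 1.
Proof. by rewrite /monomial big1 // => i _; rewrite mxE expr0z. Qed.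

Lemma monomialD z m m' : torus z ->
  monomial z (m + m') = monomial z m * monomial z m'.
Proof.
move=> zT; rewrite -big_split; apply: eq_bigr => i _ /=.
by rewrite mxE expfzDr.
Qed.

Lemma monomial_neq0 z m : torus z -> monomial z m != 0.
Proof. by move=> zT; apply/prodf_neq0 => i _; rewrite expfz_neq0. Qed.

Section Variety.
Variable D : set 'rV[R]_n.

(* the graded semigroup {(k, m) | m in k D} of lattice points of the cone
   over D *)
Definition cone_semigroup : set (nat * lattice) :=
  [set s | exists2 x, D x & map_mx intr s.2 = s.1%:R *: x].

(* Semigroup homomorphisms from [cone_semigroup] to multiplicative C, extended by
   0 outside [cone_semigroup], that do not vanish identically in positive
   degrees: the closed points of Spec C[cone_semigroup] away from the zero locus
   of the irrelevant ideal.  They carry the topology of pointwise convergence. *)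
Definition cone_points : set {ptws (nat * lattice) -> C} :=
  [set x | [/\ x 0 = 1,
     forall s t, cone_semigroup s -> cone_semigroup t -> x (s + t) = x s * x t,
     forall s, ~ cone_semigroup s -> x s = 0
   & exists2 s, cone_semigroup s & (0 < s.1)%N /\ x s != 0]].

(* the action of C^* that defines the grading *)
Definition cone_eq (x y : cone_points) : bool :=
  `[< exists2 c : C, c != 0 & forall s, set_val y s = c ^+ s.1 * set_val x s >].

Lemma cone_eq_refl : reflexive cone_eq.
Proof.
move=> x; apply/asboolP; exists 1; first exact: oner_neq0.
by move=> s; rewrite expr1n mul1r.
Qed.

Lemma cone_eq_impl x y : cone_eq x y -> cone_eq y x.
Proof.
move=> /asboolP[c c0 xy]; apply/asboolP; exists c^-1; first by rewrite invr_eq0.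
by move=> s; rewrite xy exprVn mulKf // expf_neq0.
Qed.

Lemma cone_eq_sym : symmetric cone_eq.
Proof. by move=> x y; apply/idP/idP; exact: cone_eq_impl. Qed.

Lemma cone_eq_trans : transitive cone_eq.
Proof.
move=> y x z /asboolP[c c0 xy] /asboolP[d d0 yz]; apply/asboolP.
exists (d * c); first by rewrite mulf_neq0.
by move=> s; rewrite yz xy exprMn mulrA.
Qed.

Definition cone_equiv :=
  EquivRel cone_eq cone_eq_refl cone_eq_sym cone_eq_trans.

(* The complex toric variety defined by the polytope D, as the set of closed
   points of Proj C[cone_semigroup]. *)
Definition Tor := quotient_topology {eq_quot cone_equiv}.

Definition to_Tor (x : cone_points) : Tor := \pi_Tor x.

(* homogeneous coordinates of [p], indexed by [cone_semigroup] *)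
Definition Tor_coord (p : Tor) : nat * lattice -> C := set_val (repr p).

(* the element \sum_(u <- a) u.1 x^(d, u.2) of degree d of C[cone_semigroup] *)
Definition form_eval (d : nat) (a : seq (C * lattice))
    (x : nat * lattice -> C) : C :=
  \sum_(u <- a) u.1 * x (d, u.2).

Definition Tor_germs : germs C Tor :=
  fun p g => exists (d : nat) (a b : seq (C * lattice)),
    form_eval d b (Tor_coord p) != 0 /\
    forall q, form_eval d b (Tor_coord q) != 0 ->
      g q = form_eval d a (Tor_coord q) / form_eval d b (Tor_coord q).

(* the embedding of the torus in its toric variety, as a relation *)
Definition Tor_of_torus (z : 'rV[C]_n) (p : Tor) :=
  exists2 x : cone_points, p = to_Tor x
    & forall s, cone_semigroup s -> set_val x s = monomial z s.2.

Definition torus_act (z : 'rV[C]_n) (x : nat * lattice -> C) :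
    {ptws (nat * lattice) -> C} :=
  fun s => monomial z s.2 * x s.

Lemma torus_act_subproof (z : torus) (x : cone_points) :
  torus_act (set_val z) (set_val x) \in cone_points.
Proof.
have zT := set_mem (valP z); apply/mem_set.
have [x0 xM xS [s Ss [s0 xs]]] := set_mem (valP x).
have actE t : torus_act (set_val z) (set_val x) t =
  monomial (set_val z) t.2 * \val x t by [].
split.
- by rewrite actE x0 monomial0 mulr1.
- by move=> t u St Su; rewrite !actE monomialD // xM // mulrACA.
- by move=> t St; rewrite actE xS // mulr0.
- by exists s => //; split=> //; rewrite mulf_neq0 ?monomial_neq0.
Qed.

Definition cone_act (z : torus) (x : cone_points) : cone_points :=
  exist (fun y => y \in cone_points) _ (torus_act_subproof z x).

(* An isomorphism of toric varieties is an isomorphism of algebraic varieties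
   that restricts to a group homomorphism of the tori.  The torus of CP^n is
   the set of the points [1 : w_1 : ... : w_n] with all the w_i nonzero. *)
Definition isomorphic_to_CPn :=
  exists (f : Tor -> @proj_space R (1 + n)) (f' : proj_space (1 + n) -> Tor),
    [/\ cancel f f' /\ cancel f' f,
        algebraic_map Tor_germs (@proj_germs R (1 + n)) f,
        algebraic_map (@proj_germs R (1 + n)) Tor_germs f'
      & exists r : 'rV[C]_n -> 'rV[C]_n,
          {in torus &, {morph r : z w / torus_mul z w}} /\
          forall z p, torus z -> Tor_of_torus z p ->
            torus (r z) /\ val (f p) = <[row_mx (const_mx 1) (r z)]>%VS].

End Variety.
End Toric.

Arguments torus {R n}.
Arguments Tor {R n} D.

Section Hypersurface.
Context {R : realType} {n : nat}.
Local Notation C := (cplx R).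
Variable P : mpoly n C.

Definition hypersurface : set 'rV[C]_n := torus `&` [set z | meval (z 0) P = 0].

Definition exponent (m : multinom n) : 'rV[int]_n := \row_i (m i)%:Z.

Definition real_exponent (m : multinom n) : 'rV[R]_n := \row_i (m i)%:R.

Definition newton_polytope : set 'rV[R]_n :=
  smallest (@convex_set R _) [set real_exponent m | m in [set` msupp P]].

(* The polytope and its set of vertices have the same affine hull. *)
Definition newton_dim : nat :=
  \dim <<[seq real_exponent m - real_exponent m' | m <- msupp P,
                                                   m' <- msupp P]>>%VS.

Definition closure_in_Tor : set (Tor newton_polytope) :=
  closure [set p | exists2 z, hypersurface z & Tor_of_torus z p].

(* [closure_in_Tor] is the zero locus of the section sum_m a_m x^(1, m), where P
   is sum_m a_m z^m.  This polynomial in z is the value of the section at z.x; if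
   x is the base point of the orbit of a face F, it is the truncation of P to
   F. *)
Definition orbit_equation (x : cone_points newton_polytope) : mpoly n C :=
  \sum_(m <- msupp P)
    (mcoeff m P * set_val x (1%N, exponent m)) *: mpolyX C m.

(* [closure_in_Tor] intersected with the orbit of [x] is non-singular, as the
   scheme cut out in the orbit by the equation of [closure_in_Tor].  The orbit
   map z |-> z.x from the torus onto the orbit is a submersion, so this is
   tested on the pull-back to the torus. *)
Definition nonsingular_in_orbit (x : cone_points newton_polytope) :=
  forall z : torus, closure_in_Tor (to_Tor (cone_act z x)) ->
    exists i, meval (set_val z 0) (mderiv i (orbit_equation x)) != 0.

Definition torically_nonsingular :=
  newton_dim = n /\ forall x, nonsingular_in_orbit x.

Definition torically_projective := isomorphic_to_CPn newton_polytope.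

Definition log_gradient (z : 'rV[C]_n) : 'rV[C]_n :=
  \row_i (z 0 i * meval (z 0) (mderiv i P)).

(* [f] is an algebraic map that restricts on the hypersurface to the
   logarithmic Gauss map. *)
Definition extended_log_gauss_map (f : closure_in_Tor -> @proj_space R n) :=
  algebraic_map (restrict_germs (@Tor_germs R n newton_polytope)
                   (Y := closure_in_Tor))
                (@proj_germs R n) f /\
  forall z (p : closure_in_Tor), hypersurface z ->
    Tor_of_torus z (set_val p) -> val (f p) = <[log_gradient z]>%VS.

End Hypersurface.

Arguments closure_in_Tor {R n} P.

(* Main.v *)
Require Import Defs.
From mathcomp Require mpoly.
Import -(notations) mpoly.
From mathcomp Require Import all_boot all_order all_algebra.
From mathcomp Require Import all_classical all_reals all_analysis.
From mathcomp Require Import closed_field complex ring.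

Set Implicit Arguments.
Unset Strict Implicit.
Unset Printing Implicit Defensive.

Import Order.TTheory GRing.Theory Num.Theory.
Import numFieldNormedType.Exports.
Local Open Scope classical_set_scope.
Local Open Scope ring_scope.
Local Open Scope quotient_scope.

(** Let P be the sum of the a_m z^m, and let S be the graded semigroup of the
    lattice points (k, m) of the cone over the Newton polytope.  A point of the
    toric variety has homogeneous coordinates x (k, m), indexed by S.  The
    sections

      F (x) = sum_m a_m x (1, m)   and   G_i (x) = sum_m a_m m_i x (1, m)

    of the ample line bundle O(1) pull back to P and to the coordinates of its
    logarithmic gradient on the torus, so the closure of the hypersurface lies in
    the zero locus of F, and the extended Gauss map is [G_1 : ... : G_n]
    ([log_gauss_map_closure]).  The n + 1 sections F, G_1, ..., G_n have no common
    zero, since such a zero would be a singular point of the closure in its orbit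
    ([no_common_zero]).  A morphism given by sections of an ample line bundle
    without common zeros has finite fibres.

    The last principle is proved directly.  After a rescaling, the points of the
    fibre over the line spanned by a vector v are represented by points x of the
    affine cone with F (x) = 0 and G (x) = v.  The semigroup S is generated by
    finitely many elements ([gordan]), so x is determined by its coordinates at
    these, which satisfy the binomial relations between the generators.  On a
    sphere, which is compact, the system F = 0, G = 0 together with all the
    binomial relations has no solution; hence finitely many of the relations
    suffice to bound the solutions of F = 0, G = v
    ([fiber_system_bounded]).  A bounded algebraic subset of C^N is finite
    ([bounded_algebraic_set_finite]): its projections to the axes are
    constructible by quantifier elimination, hence finite or cofinite, and being
    bounded they are finite.

    To exclude common zeros of F and G_1, ..., G_n one must know that every zero
    x of F belongs to the closure of the hypersurface ([closure_of_equation]).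
    The coordinates of x that do not vanish form a face of S.  The character of
    this face defined by x extends to a point w of the torus
    ([character_monomial]), and by the lemma of Farkas the face is cut out by an
    integral functional l ([face_functional]), so x is the limit of w s^l as s
    tends to 0 ([cone_point_orbit]).  Moving w s^l in a generic direction a of the
    torus as well, the condition that w s^l t^a lies on the hypersurface is a
    polynomial equation in t, whose coefficients depend on s.  At s = 0 it is not
    trivial and has the root 1; by continuity of roots it has roots near 1 for
    small s ([exists_close_root]), and these give points of the hypersurface that
    tend to x. *)

(** * Definable sets over algebraically closed fields *)

Section Definable.
Variable F : closedFieldType.

Lemma rterm_poly (t : GRing.term F) (i : nat) (e : seq F) : GRing.rterm t ->
  exists p : {poly F}, forall x, GRing.eval (set_nth 0 e i x) t = p.[x].
Proof.
elim: t => //=.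
- move=> j _; have [->|ji] := eqVneq j i.
    by exists 'X => x; rewrite nth_set_nth /= eqxx hornerX.
  by exists (e`_j)%:P => x; rewrite nth_set_nth /= (negbTE ji) hornerC.
- by move=> c _; exists c%:P => x; rewrite hornerC.
- by move=> n _; exists n%:R%:P => x; rewrite hornerC.
- move=> t IHt u IHu /andP[/IHt[p Ep] /IHu[q Eq]]; exists (p + q) => x.
  by rewrite Ep Eq hornerD.
- by move=> t IHt /IHt[p Ep]; exists (- p) => x; rewrite Ep hornerN.
- by move=> t IHt n /IHt[p Ep]; exists (p *+ n) => x; rewrite Ep hornerMn.
- move=> t IHt u IHu /andP[/IHt[p Ep] /IHu[q Eq]]; exists (p * q) => x.
  by rewrite Ep Eq hornerM.
- by move=> t IHt n /IHt[p Ep]; exists (p ^+ n) => x; rewrite Ep horner_exp.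
Qed.

Definition finite_or_cofinite (b : F -> bool) : Prop :=
  exists s : seq F, (forall x, b x -> x \in s) \/ (forall x, ~~ b x -> x \in s).

Lemma finite_or_cofiniteN b :
  finite_or_cofinite b -> finite_or_cofinite (fun x => ~~ b x).
Proof.
by case=> s [] H; exists s; [right | left] => x; rewrite ?negbK => /H.
Qed.

Lemma finite_or_cofiniteI b c :
  finite_or_cofinite b -> finite_or_cofinite c -> finite_or_cofinite (fun x => b x && c x).
Proof.
case=> s [] Hs [t Ht]; first by exists s; left => x /andP[/Hs].
case: Ht => Ht; first by exists t; left => x /andP[_ /Ht].
exists (s ++ t); right => x; rewrite negb_and mem_cat.
by case/orP => [/Hs->|/Ht->]; rewrite ?orbT.
Qed.

Lemma eq_finite_or_cofinite b c : b =1 c -> finite_or_cofinite b -> finite_or_cofinite c.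
Proof.
move=> bc [s Hs]; exists s.
by case: Hs => H; [left | right] => x; rewrite -bc => /H.
Qed.

Lemma qf_finite_or_cofinite (f : GRing.formula F) (i : nat) (e : seq F) :
  GRing.qf_form f -> GRing.rformula f ->
  finite_or_cofinite (fun x => GRing.qf_eval (set_nth 0 e i x) f).
Proof.
elim: f => //=.
- by move=> b _ _; exists [::]; case: b; [right | left].
- move=> t u _ /andP[/rterm_poly-/(_ i e)[p Ep] /rterm_poly-/(_ i e)[q Eq]].
  have E x : (GRing.eval (set_nth 0 e i x) t == GRing.eval (set_nth 0 e i x) u)
     = root (p - q) x by rewrite Ep Eq rootE hornerD hornerN subr_eq0.
  apply: eq_finite_or_cofinite (fun x => esym (E x)) _.
  have [->|pq0] := eqVneq (p - q) 0.
    by exists [::]; right => x; rewrite root0.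
  have [r Er] := closed_field_poly_normal (p - q).
  exists r; left => x; rewrite Er rootZ ?lead_coef_eq0 //.
  by rewrite root_prod_XsubC.
- move=> f IHf g IHg /andP[qf qg] /andP[rf rg].
  by apply: finite_or_cofiniteI; [apply: IHf | apply: IHg].
- move=> f IHf g IHg /andP[qf qg] /andP[rf rg].
  have := finite_or_cofiniteN (finite_or_cofiniteI
    (finite_or_cofiniteN (IHf qf rf)) (finite_or_cofiniteN (IHg qg rg))).
  by apply: eq_finite_or_cofinite => x; rewrite negb_and !negbK.
- move=> f IHf g IHg /andP[qf qg] /andP[rf rg].
  have := finite_or_cofiniteN (finite_or_cofiniteI
    (IHf qf rf) (finite_or_cofiniteN (IHg qg rg))).
  by apply: eq_finite_or_cofinite => x; rewrite negb_and !negbK implybE.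
- by move=> f IHf qf rf; apply: finite_or_cofiniteN; apply: IHf.
Qed.

(** Eliminating the quantifiers leaves a Boolean combination of polynomial
    equations in one unknown, each of which holds identically or has finitely
    many solutions. *)
Lemma definable_finite_or_cofinite (f : GRing.formula F) (i : nat) (e : seq F) :
  exists s : seq F, (forall x, GRing.holds (set_nth 0 e i x) f -> x \in s) \/
                    (forall x, ~ GRing.holds (set_nth 0 e i x) f -> x \in s).
Proof.
have wf := @ClosedFieldQE.wf_ex_elim F.
have ok := ClosedFieldQE.holds_ex_elim (@solve_monicpoly F).
have rf := GRing.to_rform_rformula f.
have P e' := GRing.quantifier_elim_rformP wf ok e' rf.
have /andP[qf' rf'] := GRing.quantifier_elim_wf wf rf.
have [s Hs] := qf_finite_or_cofinite i e qf' rf'; exists s.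
case: Hs => H; [left | right] => x Hx; apply: H.
  by apply/P/GRing.to_rformP.
by apply/P => /GRing.to_rformP.
Qed.

End Definable.

Section Bounded.
Variable C : numClosedFieldType.

Lemma cofinite_unbounded (s : seq C) (M : C) : exists2 x, x \notin s & ~~ (`|x| <= M).
Proof.
pose B := `|M| + \sum_(y <- s) `|y| + 1.
have s0 : 0 <= \sum_(y <- s) `|y| by apply: sumr_ge0.
have B0 : 0 <= B by rewrite !addr_ge0.
exists B; last first.
  apply/negP; rewrite ger0_norm // => BM.
  have M0 := le_trans B0 BM; move: BM.
  by rewrite /B (ger0_norm M0) -addrA gerDl lt_geF ?ltr_wpDl.
apply/negP => Bs; suff : `|B| <= \sum_(y <- s) `|y|.
  by rewrite ger0_norm // /B addrAC gerDr lt_geF ?ltr_wpDl.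
by rewrite (big_rem _ Bs) /= lerDl sumr_ge0.
Qed.

(** The projection to each axis is again definable, so it is finite or
    cofinite, and a cofinite set of numbers is not bounded. *)
Lemma bounded_definable_finite (f : GRing.formula C) (N : nat) (M : C) :
  (forall e, size e = N -> GRing.holds e f -> forall i, `|e`_i| <= M) ->
  exists s : seq C,
    forall e, size e = N -> GRing.holds e f -> forall i, (i < N)%N -> e`_i \in s.
Proof.
move=> bdd.
suff H i : (i < N)%N -> exists s : seq C,
    forall e, size e = N -> GRing.holds e f -> e`_i \in s.
  have /boolp.choice[t tP] (i : nat) : exists s : seq C, (i < N)%N ->
      forall e, size e = N -> GRing.holds e f -> e`_i \in s.
    have [iN|] := boolP (i < N)%N; last by exists [::].
    by have [s sP] := H i iN; exists s.
  exists (flatten [seq t i | i <- iota 0 N]) => e eN ef i iN.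
  apply/flattenP; exists (t i); last exact: tP.
  by apply: map_f; rewrite mem_iota.
move=> iN.
(* All variables but X_i are bound, so g defines the i-th projection. *)
pose I := [seq j <- iota 0 N | j != i].
pose g := foldr GRing.Exists f I.
have gP x : GRing.holds (set_nth 0 (nseq N 0) i x) g <->
  exists e, [/\ size e = N, GRing.holds e f & e`_i = x].
  rewrite -GRing.foldExistsP; split=> [[e' ee' fe']|[e [eN ef <-]]].
    exists (mkseq (fun j => e'`_j) N); split; first by rewrite size_mkseq.
      apply: GRing.eq_holds fe' => j.
      have [jN|jN] := ltnP j N; first by rewrite nth_mkseq.
      rewrite [RHS]nth_default ?size_mkseq // -ee'.
        rewrite nth_set_nth /= ifN ?gtn_eqF //; last exact: leq_trans jN.
        by rewrite nth_nseq ltnNge jN.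
      by rewrite !inE mem_filter mem_iota /= ltnNge jN andbF.
    rewrite nth_mkseq // -ee' ?nth_set_nth /= ?eqxx //.
    by rewrite !inE mem_filter eqxx.
  exists e => // j; rewrite !inE mem_filter mem_iota negb_and negbK /= nth_set_nth /=.
  have [->//|ji /=] := eqVneq j i.
  by rewrite -leqNgt => Nj; rewrite nth_nseq ltnNge Nj /= nth_default ?eN.
have [s [Hs|Hs]] := definable_finite_or_cofinite g i (nseq N 0).
  by exists s => e eN ef; apply/Hs/gP; exists e.
have [x xs /negP[]] := cofinite_unbounded s M.
suff /gP[e [eN ef <-]] : GRing.holds (set_nth 0 (nseq N 0) i x) g by exact: bdd.
by apply: contrapT => /Hs xs'; rewrite xs' in xs.
Qed.

End Bounded.

Section AlgebraicSet.
Variables (C : numClosedFieldType) (N : nat).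

Definition monomial_term (m : multinom N) : GRing.term C :=
  foldr (fun i t => GRing.Mul (GRing.Exp (GRing.Var _ (i : 'I_N)) (m i)) t)
    (GRing.Const 1) (enum 'I_N).

Definition mpoly_term (p : mpoly N C) : GRing.term C :=
  foldr (fun m t => GRing.Add (GRing.Mul (GRing.Const (mcoeff m p)) (monomial_term m)) t)
    (GRing.Const 0) (msupp p).

Lemma eval_mpoly_term p (e : seq C) :
  GRing.eval e (mpoly_term p) = meval (fun i => e`_i) p.
Proof.
have monE m : GRing.eval e (monomial_term m) = \prod_(i < N) e`_i ^+ m i.
  rewrite /monomial_term -big_enum; elim: (enum 'I_N) => [|i r IH] /=.
    by rewrite big_nil.
  by rewrite big_cons IH.
rewrite mevalE /mpoly_term; elim: (msupp p) => [|m r IH] /=.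
  by rewrite big_nil.
by rewrite big_cons IH monE.
Qed.

Lemma bounded_algebraic_set_finite (sys : seq (mpoly N C)) (M : C) :
  (forall v, (forall p, p \in sys -> meval v p = 0) -> forall i, `|v i| <= M) ->
  exists s : seq C,
    forall v, (forall p, p \in sys -> meval v p = 0) -> forall i, v i \in s.
Proof.
move=> bdd.
pose f := foldr (fun p g => GRing.And (GRing.Equal (mpoly_term p) (GRing.Const 0)) g)
  (GRing.Bool true) sys.
have fP (e : seq C) : GRing.holds e f <->
    forall p, p \in sys -> meval (fun i => e`_i) p = 0.
  rewrite /f; elim: (sys) => [|p r IH] /=; first by [].
  rewrite eval_mpoly_term; split=> [[p0 /IH rP] q|H].
    by rewrite inE => /predU1P[->|/rP].
  split; first by apply: H; rewrite mem_head.
  by apply/IH => q qr; apply: H; rewrite inE qr orbT.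
have [|s sP] := @bounded_definable_finite C f N `|M|.
  move=> e eN /fP/bdd H i.
  have [iN|Ni] := ltnP i N; last by rewrite nth_default ?eN // normr0.
  have HM := H (Ordinal iN).
  by rewrite (ger0_norm (le_trans (normr_ge0 _) HM)).
exists s => v vP i.
pose e := [seq v j | j <- enum 'I_N].
have ev j : e`_(j : 'I_N) = v j.
  by rewrite (nth_map j) ?size_enum_ord // nth_ord_enum.
rewrite -ev; apply: sP => //; first by rewrite size_map size_enum_ord.
apply/fP => p pP; rewrite -[RHS](vP p pP); apply: meval_eq => j.
by rewrite ev.
Qed.

End AlgebraicSet.

(** * The lemma of Farkas *)

Definition dotv (K : comPzRingType) N (a x : 'rV[K]_N) : K := \sum_i a 0 i * x 0 i.

Section Dot.
Variables (K : comPzRingType) (N : nat).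
Implicit Types a b x y : 'rV[K]_N.

Lemma dotvC a x : dotv a x = dotv x a.
Proof. by apply: eq_bigr => i _; rewrite mulrC. Qed.

Lemma dotvDr a x y : dotv a (x + y) = dotv a x + dotv a y.
Proof. by rewrite -big_split; apply: eq_bigr => i _; rewrite mxE mulrDr. Qed.

Lemma dotvZr k a x : dotv a (k *: x) = k * dotv a x.
Proof. by rewrite /dotv mulr_sumr; apply: eq_bigr => i _; rewrite mxE mulrCA. Qed.

Lemma dotvDl a b x : dotv (a + b) x = dotv a x + dotv b x.
Proof. by rewrite !(dotvC _ x) dotvDr. Qed.

Lemma dotvZl k a x : dotv (k *: a) x = k * dotv a x.
Proof. by rewrite !(dotvC _ x) dotvZr. Qed.

Lemma dotvNl a x : dotv (- a) x = - dotv a x.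
Proof. by rewrite -scaleN1r dotvZl mulN1r. Qed.

Lemma dotv0l x : dotv 0 x = 0.
Proof. by rewrite -(scale0r 0) dotvZl mul0r. Qed.

Lemma dotv_suml I (r : seq I) (P : pred I) (A : I -> 'rV[K]_N) x :
  dotv (\sum_(i <- r | P i) A i) x = \sum_(i <- r | P i) dotv (A i) x.
Proof.
by apply: (big_morph (fun a => dotv a x)) => [a b|]; rewrite ?dotvDl ?dotv0l.
Qed.

Lemma dotv_delta a i : dotv a (delta_mx 0 i) = a 0 i.
Proof.
rewrite /dotv (bigD1 i) //= mxE !eqxx mulr1 big1 ?addr0 // => j ji.
by rewrite mxE (negbTE ji) andbF mulr0.
Qed.

End Dot.

(** Induction on the functionals, after Bartl: if g does not follow from the
    A i with i in r, some u has dotv g u > 0, hence dotv (A j) u > 0, and the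
    projection along u onto the kernel of A j reduces the claim to r. *)
Lemma farkas (K : realFieldType) N (I : eqType) (r : seq I) (A : I -> 'rV[K]_N)
    (g : 'rV[K]_N) :
  uniq r ->
  (forall x, (forall i, i \in r -> dotv (A i) x <= 0) -> dotv g x <= 0) ->
  exists2 l : I -> K, forall i, 0 <= l i & g = \sum_(i <- r) l i *: A i.
Proof.
elim: r A g => [|j r IH] A g /= => [_ gP|/andP[jr ur] gP].
  exists (fun=> 0) => //; rewrite big_nil.
  apply/rowP => i; rewrite mxE; apply/eqP; rewrite eq_le.
  have := gP (delta_mx 0 i); rewrite dotv_delta => -> //=.
  have := gP (- delta_mx 0 i); rewrite -scaleN1r dotvZr mulN1r dotv_delta oppr_le0.
  exact.
have [gP'|] := pselect (forall x, (forall i, i \in r -> dotv (A i) x <= 0) ->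
    dotv g x <= 0).
  have [l l0 ->] := IH A g ur gP'.
  exists (fun i => if i == j then 0 else l i); first by move=> i; case: ifP.
  rewrite big_cons eqxx scale0r add0r; apply: eq_big_seq => i ir.
  by rewrite ifN //; apply: contraNneq jr => <-.
move=> /existsNP[u0 /not_implyP[u0r /negP]]; rewrite -ltNge => gu0.
have Aju0 : 0 < dotv (A j) u0.
  rewrite ltNge; apply/negP => Aju0.
  move: gu0; rewrite ltNge gP // => i; rewrite inE => /predU1P[->//|/u0r //].
pose u := (dotv (A j) u0)^-1 *: u0.
have Aju : dotv (A j) u = 1 by rewrite dotvZr mulVf ?gt_eqF.
have gu : 0 < dotv g u by rewrite dotvZr mulr_gt0 ?invr_gt0.
have ur' i : i \in r -> dotv (A i) u <= 0.
  by move=> /u0r ?; rewrite dotvZr pmulr_rle0 ?invr_gt0.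
(* Precomposition with the projection along u onto the kernel of A j. *)
pose pr (a : 'rV[K]_N) := a - dotv a u *: A j.
have prE a x : dotv (pr a) x = dotv a (x - dotv (A j) x *: u).
  rewrite /pr dotvDl dotvNl dotvZl dotvDr -[- (_ *: u)]scaleNr (dotvZr _ a u) mulNr.
  by rewrite mulrC.
have [x xr|l l0 gE] := IH (pr \o A) (pr g) ur.
  rewrite prE; apply: gP => i; rewrite inE => /predU1P[->|ir].
    by rewrite dotvDr -[- (_ *: u)]scaleNr (dotvZr _ _ u) Aju mulr1 subrr.
  by rewrite -prE; exact: xr.
pose c := dotv g u - \sum_(i <- r) l i * dotv (A i) u.
exists (fun i => if i == j then c else l i).
  move=> i; case: ifP => // _; rewrite subr_ge0.
  apply: (le_trans _ (ltW gu)); rewrite big_seq; apply: sumr_le0 => k kr.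
  by rewrite mulr_ge0_le0 // ur'.
rewrite big_cons eqxx.
have -> : \sum_(i <- r) (if i == j then c else l i) *: A i = \sum_(i <- r) l i *: A i.
  by apply: eq_big_seq => i ir; rewrite ifN //; apply: contraNneq jr => <-.
have -> : g = pr g + dotv g u *: A j by rewrite subrK.
rewrite gE /c scalerBl addrC -addrA; congr (_ + _).
under eq_bigr do rewrite /= /pr scalerBr scalerA.
by rewrite sumrB -scaler_suml addrC.
Qed.

Lemma common_denominator (I : finType) (l : I -> rat) :
  exists2 d : nat, (0 < d)%N & exists z : I -> int, forall i, d%:R * l i = (z i)%:~R.
Proof.
exists (\prod_i `|denq (l i)|)%N.
  by apply: prodn_gt0 => i; rewrite absz_gt0 denq_eq0.
have H i : exists z : int, (\prod_j `|denq (l j)|)%N%:R * l i = z%:~R.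
  exists ((\prod_(j | j != i) `|denq (l j)|)%N%:Z * numq (l i)).
  rewrite (bigD1 i) //= natrM mulrAC rmorphM /= -pmulrn [RHS]mulrC; congr (_ * _).
  rewrite numqE mulrC; congr (_ * _).
  by rewrite pmulrn absz_denq.
by exists (fun i => projT1 (cid (H i))) => i; case: cid.
Qed.

(** The hypothesis on Phi says that the b i with Phi i generate a face of the
    monoid generated by all the b i.  For i off this face, - b i is not a rational
    combination of the b j with coefficients that are nonnegative off the face,
    so the lemma of Farkas gives a functional that is nonnegative on the monoid,
    vanishes on the face and is positive at b i.  The sum of these functionals
    over all i works. *)
Lemma face_functional N (I : finType) (b : I -> 'rV[int]_N) (Phi : pred I) :
  (forall p q : I -> nat,
     \sum_i b i *+ p i = \sum_(i | Phi i) b i *+ q i ->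
     forall i, (0 < p i)%N -> Phi i) ->
  exists2 l : 'rV[int]_N, forall i, 0 <= dotv l (b i)
    & forall i, (dotv l (b i) == 0) = Phi i.
Proof.
move=> PhiP.
pose br i : 'rV[rat]_N := map_mx intr (b i).
have H i : ~~ Phi i -> exists y, [/\ forall j, 0 <= dotv (br j) y,
    forall j, Phi j -> dotv (br j) y = 0 & 0 < dotv (br i) y].
  move=> Phii; apply: contrapT => noy.
  pose A (s : I + I) := match s with
    | inl j => - br j | inr j => if Phi j then br j else 0 end.
  have [|y yA|l l0 biE] := @farkas _ _ _ (enum {: I + I}) A (br i).
  - exact: enum_uniq.
  - rewrite leNgt; apply/negP => iy; apply: noy; exists y.
    have y0 j : 0 <= dotv (br j) y.
      by have := yA (inl j); rewrite mem_enum dotvNl oppr_le0; apply.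
    split=> // j Phij; apply/eqP; rewrite eq_le y0 andbT.
    by have := yA (inr j); rewrite mem_enum /A Phij; apply.
  have [d d0 [z zE]] := common_denominator l.
  have z0 s : 0 <= z s.
    by rewrite -(ler0z rat) -zE mulr_ge0.
  have := PhiP (fun j => `|z (inl j)| + d * (j == i))%N (fun j => `|z (inr j)|%N) _ i.
  rewrite eqxx muln1 addn_gt0 d0 orbT (negbTE Phii) => F; suff /F: 
   \sum_j b j *+ (`|z (inl j)| + d * (j == i)) =
   \sum_(j | Phi j) b j *+ `|z (inr j)| by move=> /(_ isT).
  have inj : injective (map_mx intr : 'rV[int]_N -> 'rV[rat]_N).
    by move=> u v /rowP E; apply/rowP => k; have := E k; rewrite !mxE => /intr_inj.
  apply: inj.
  rewrite !raddf_sum /=.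
  under eq_bigr do rewrite raddfMn /= mulrnDr -scaler_nat pmulrn gez0_abs // -zE.
  under [RHS]eq_bigr do rewrite raddfMn /= -scaler_nat pmulrn gez0_abs // -zE.
  rewrite big_split /= [X in _ + X](bigD1 i) //= eqxx muln1 [X in _ + (_ + X)]big1; last first.
    by move=> j /negbTE ->; rewrite muln0.
  rewrite addr0 -/(br i) biE -scaler_nat big_enum big_sumType /= scalerDr addrA.
  rewrite !scaler_sumr -big_split big1 ?add0r /=; last first.
    move=> j _. by rewrite !scalerN scalerA subrr.
  rewrite [RHS]big_mkcond; apply: eq_big => // j _; rewrite scalerA.
  by case: ifP; rewrite ?scaler0.
have H' i : exists y, [/\ forall j, 0 <= dotv (br j) y,
    forall j, Phi j -> dotv (br j) y = 0 & ~~ Phi i -> 0 < dotv (br i) y].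
  have [Phii|/H[y [y1 y2 y3]]] := boolP (Phi i); last by exists y.
  by exists 0; split => // j *; rewrite dotvC dotv0l.
have /boolp.choice[y yP] := H'.
pose w := \sum_i y i.
have wE j : dotv w (br j) = \sum_i dotv (br j) (y i).
  by rewrite dotv_suml; apply: eq_bigr => i _; rewrite dotvC.
have [d d0 [z zE]] := common_denominator (fun i => w 0 i).
have zb j : (dotv (\row_i z i) (b j))%:~R = d%:R * dotv w (br j).
  rewrite /dotv mulr_sumr rmorph_sum; apply: eq_bigr => i _.
  by rewrite !mxE rmorphM /= -zE mulrA.
exists (\row_i z i) => j.
  rewrite -(ler0z rat) zb mulr_ge0 // wE sumr_ge0 // => i _.
  by have [-> _ _] := yP i.
rewrite -(intr_eq0 rat) zb mulf_eq0 pnatr_eq0 (gtn_eqF d0) /= wE.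
have [Phij|nPhij] := boolP (Phi j).
  by rewrite big1 ?eqxx // => i _; have [_ /(_ j Phij)] := yP i.
apply/negbTE; rewrite gt_eqF // (bigD1 j) //=; have [_ _ /(_ nPhij) ?] := yP j.
by rewrite ltr_wpDr // sumr_ge0 // => i _; have [-> _ _] := yP i.
Qed.

(** * Extension of characters *)

Section CharacterExtension.
Variables (C : numClosedFieldType) (V : zmodType).

(** A character of a subgroup of V, given by its graph: extending it to a
    larger subgroup then only adds points to a relation. *)
Record is_partial_char (G : V -> C -> Prop) : Prop := IsPartialChar {
  pchar0 : G 0 1;
  pcharD : forall u v a b, G u a -> G v b -> G (u + v) (a * b);
  pcharN : forall u a, G u a -> G (- u) a^-1;
  pchar_neq0 : forall u a, G u a -> a != 0;
  pchar_eq1 : forall a, G 0 a -> a = 1 }.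

Lemma pcharMz G u a (k : int) : is_partial_char G -> G u a -> G (u *~ k) (a ^ k).
Proof.
move=> GP Gua; have nat n : G (u *+ n) (a ^+ n).
  elim: n => [|n IH]; first by rewrite mulr0n expr0; exact: pchar0.
  by rewrite mulrS exprS; exact: (pcharD GP).
case: k => n; first exact: nat.
by rewrite NegzE mulrNz -invr_expz; apply: (pcharN GP); exact: nat.
Qed.

Lemma pchar_fun G u a b : is_partial_char G -> G u a -> G u b -> a = b.
Proof.
move=> GP Ga Gb; have b0 := pchar_neq0 GP Gb.
have := pcharD GP Ga (pcharN GP Gb); rewrite subrr => /(pchar_eq1 GP) E.
by apply: (mulIf (_ : b^-1 != 0)); rewrite ?invr_eq0 // E mulfV.
Qed.

(** The multiplicative group of C is divisible: if d e is the least positive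
    multiple of e in the domain of G, then e can be sent to any d-th root of the
    value of G at d e. *)
Lemma pchar_extend_by G e : is_partial_char G ->
  exists H t, [/\ is_partial_char H, forall u a, G u a -> H u a & H e t].
Proof.
move=> GP.
(* The value at e is forced on the multiples of e in the domain of G. *)
have [t t0 tP] : exists2 t : C, t != 0 & forall k a, G (e *~ k) a -> a = t ^ k.
  pose K (n : nat) := (0 < n)%N && `[< exists a, G (e *+ n) a >].
  have [exK|noK] := pselect (exists n, K n).
    case: (ex_minnP exK) => d /andP[d0 /asboolP[al Gal]] dmin.
    exists (d.-root al); first by rewrite rootC_eq0 // (pchar_neq0 GP Gal).
    move=> k a Gka.
    have Gq := pcharMz (k %/ d)%Z GP Gal.
    have := pcharD GP Gka (pcharN GP Gq).
    rewrite pmulrn -mulrzA -mulrzBr mulrC {1}(divz_eq k d) addrAC subrr add0r => Gr.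
    have r0 : (k %% d)%Z = 0.
      have := modz_ge0 k (_ : d%:Z != 0); rewrite -lt0n => /(_ d0).
      have := ltz_pmod k (_ : 0 < d%:Z); rewrite ltz_nat => /(_ d0).
      case: (modz k d) Gr => // r Gr; rewrite ltz_nat => rd _.
      have [->//|r0] := posnP r.
      suff /dmin : K r by rewrite leqNgt rd.
      by rewrite /K r0; apply/asboolP; exists (a / al ^ (k %/ d)%Z).
    move: Gr; rewrite r0 mulr0z => /(pchar_eq1 GP) E.
    have al0 := pchar_neq0 GP Gq.
    have -> : a = al ^ (k %/ d)%Z.
      by apply: (mulIf (_ : (al ^ (k %/ d)%Z)^-1 != 0)); rewrite ?invr_eq0 // E mulfV.
    by rewrite [in RHS](divz_eq k d) r0 addr0 mulrC -exprz_exp -exprnP rootCK.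
  exists 1; first exact: oner_neq0.
  have noK' n a : (0 < n)%N -> ~ G (e *+ n) a.
    by move=> n0 Gn; apply: noK; exists n; rewrite /K n0; apply/asboolP; exists a.
  move=> k a; rewrite exp1rz; case: k => n.
    case: n => [|n]; first by rewrite mulr0z => /(pchar_eq1 GP).
    by move=> /noK'-/(_ isT).
  by move=> /(pcharN GP); rewrite NegzE mulrNz opprK => /noK'-/(_ isT).
exists (fun w c => exists u a k, [/\ G u a, w = u + e *~ k & c = a * t ^ k]), t.
split; last 1 first.
- by exists 0, 1, 1; split; rewrite ?add0r ?mul1r //; exact: pchar0.
- split.
  + by exists 0, 1, 0; split; rewrite ?mulr0z ?addr0 ?mulr1 //; exact: pchar0.
  + move=> _ _ _ _ [u [a [k [Gu -> ->]]]] [v [b [l [Gv -> ->]]]].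
    exists (u + v), (a * b), (k + l); split; first exact: (pcharD GP).
      by rewrite mulrzDr addrACA.
    by rewrite expfzDr // mulrACA.
  + move=> _ _ [u [a [k [Gu -> ->]]]]; exists (- u), a^-1, (- k).
    by split; [exact: (pcharN GP) | rewrite mulrNz opprD | rewrite invfM invr_expz].
  + move=> _ _ [u [a [k [Gu _ ->]]]].
    by rewrite mulf_neq0 ?(pchar_neq0 GP Gu) ?expfz_neq0.
  + move=> c [u [a [k [Gu /esym/eqP + ->]]]]; rewrite addr_eq0 => /eqP uE.
    have := pcharN GP Gu; rewrite {1}uE opprK => /tP <-.
    by rewrite mulfV // (pchar_neq0 GP Gu).
- by move=> u a Gu; exists u, a, 0; split; rewrite ?mulr0z ?addr0 ?mulr1.
Qed.

Lemma pchar_extend_seq G (r : seq V) : is_partial_char G ->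
  exists H, [/\ is_partial_char H, forall u a, G u a -> H u a
              & forall e, e \in r -> exists t, H e t].
Proof.
elim: r G => [|e r IH] G GP; first by exists G; split.
have [H [t [HP GH Het]]] := pchar_extend_by e GP.
have [K [KP HK Kr]] := IH H HP; exists K; split=> //.
  by move=> u a /GH/HK.
by move=> f; rewrite inE => /predU1P[->|/Kr//]; exists t; exact: HK.
Qed.

End CharacterExtension.

Section MonomialCharacter.
Variables (R : realType) (N : nat).
Local Notation C := (cplx R).

(** A character of a submonoid of the lattice extends first to the subgroup
    that it generates, by differences, then to the whole lattice; characters of
    the lattice are points of the torus. *)
Lemma character_monomial (Phi : set 'rV[int]_N) (chi : 'rV[int]_N -> C) :
  Phi 0 -> (forall u v, Phi u -> Phi v -> Phi (u + v)) ->
  (forall u, Phi u -> chi u != 0) ->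
  (forall u v, Phi u -> Phi v -> chi (u + v) = chi u * chi v) ->
  exists2 z : 'rV[C]_N, torus z & forall u, Phi u -> chi u = monomial z u.
Proof.
move=> Phi0 PhiD chi_neq0 chiD.
have chi0 : chi 0 = 1.
  have := chiD _ _ Phi0 Phi0; rewrite addr0 => /esym E.
  by apply: (mulIf (chi_neq0 _ Phi0)); rewrite mul1r.
pose G w c := exists u v, [/\ Phi u, Phi v, w = u - v & c = chi u / chi v].
have GP : is_partial_char G.
  split.
  - by exists 0, 0; split; rewrite ?subrr ?chi0 ?divr1.
  - move=> _ _ _ _ [u [v [Pu Pv -> ->]]] [u' [v' [Pu' Pv' -> ->]]].
    exists (u + u'), (v + v'); split; try exact: PhiD.
      by rewrite opprD addrACA.
    by rewrite !chiD // invfM mulrACA.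
  - move=> _ _ [u [v [Pu Pv -> ->]]]; exists v, u.
    by split; rewrite ?opprB // invfM invrK mulrC.
  - move=> w c [u [v [Pu Pv _ ->]]].
    by rewrite mulf_neq0 ?invr_eq0 ?chi_neq0.
  - move=> c [u [v [Pu Pv /esym/eqP + ->]]]; rewrite subr_eq0 => /eqP ->.
    by rewrite mulfV // chi_neq0.
have [H [HP GH Hr]] := pchar_extend_seq [seq delta_mx 0 i | i <- enum 'I_N] GP.
have /boolp.choice[t tP] (i : 'I_N) : exists t, H (delta_mx 0 i) t.
  by apply: Hr; apply: map_f; rewrite mem_enum.
exists (\row_i t i) => [i|u Pu]; first by rewrite mxE (pchar_neq0 HP (tP i)).
apply: (pchar_fun HP (GH _ _ (_ : G u _))).
  by exists u, 0; split; rewrite ?subr0 ?chi0 ?divr1.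
rewrite {1}(_ : u = \sum_i delta_mx 0 i *~ u 0 i); last first.
  rewrite [LHS]row_sum_delta; apply: eq_bigr => i _.
  by rewrite -scaler_int intz.
rewrite /monomial.
apply: (big_rec2 (fun w c => H w c)) => [|i w c _ Hwc]; first exact: pchar0.
by apply: (pcharD HP) => //; rewrite mxE; exact: pcharMz.
Qed.

End MonomialCharacter.

(** * Continuity of roots *)

Lemma base_expansion_inj n (K : nat) (f g : 'I_n -> nat) :
  (forall i, f i < K)%N -> (forall i, g i < K)%N ->
  (\sum_i f i * K ^ i = \sum_i g i * K ^ i)%N -> f =1 g.
Proof.
elim: n f g => [|n IH] f g fK gK; first by move=> _ [].
have E h : (\sum_(i < n.+1) h i * K ^ i = h ord0 + (\sum_(i < n) h (lift ord0 i) * K ^ i) * K)%N.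
  rewrite big_ord_recl expn0 muln1 big_distrl /=; congr addn.
  by apply: eq_bigr => i _; rewrite -mulnA -expnSr.
rewrite !E => H.
have K0 : (0 < K)%N by apply: leq_trans (fK ord0).
have H0 : f ord0 = g ord0.
  by move: (congr1 (modn^~ K) H); rewrite ![(_ + _ * K)%N]addnC !modnMDl !modn_small.
have H1 : f \o lift ord0 =1 g \o lift ord0.
  apply: IH => [i|i|]; [exact: fK | exact: gK|].
  move: H; rewrite H0 => /addnI/eqP; rewrite eqn_pmul2r // => /eqP; exact.
by move=> i; case: (unliftP ord0 i) => [j ->|->]; [exact: H1 | exact: H0].
Qed.

Section RootContinuity.
Variable C : numClosedFieldType.

(** Each factor t - x of q.[t], for x a root of q, exceeds the factor a - x of
    q.[a] at most by a factor 1 + `|t - a| / d, because `|a - x| >= d. *)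
Lemma horner_no_close_root (q : {poly C}) (a t d : C) L : 0 < d ->
  (size q <= L.+1)%N -> (forall r, root q r -> ~~ (`|a - r| < d)) ->
  `|q.[t]| <= `|q.[a]| * (1 + `|t - a| / d) ^+ L.
Proof.
move=> d0 sq far; have [->|q0] := eqVneq q 0.
  by rewrite !horner0 normr0 mul0r.
have [r qE] := closed_field_poly_normal q.
have rfar x : x \in r -> d <= `|a - x|.
  move=> xr; rewrite real_leNgt ?normr_real ?gtr0_real //; apply: far.
  by rewrite qE rootZ ?lead_coef_eq0 // root_prod_XsubC.
have sr : (size r <= L)%N.
  by rewrite -ltnS (leq_trans _ sq) // qE size_scale ?lead_coef_eq0 // size_prod_XsubC.
set w := 1 + _; have w1 : 1 <= w by rewrite lerDl divr_ge0 // ltW.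
rewrite qE !hornerZ !normrM -mulrA ler_wpM2l //.
apply: (@le_trans _ _ (`|(\prod_(z <- r) ('X - z%:P)).[a]| * w ^+ size r)); last first.
  by rewrite ler_wpM2l // ler_weXn2l.
elim: r rfar {qE sr} => [|x r IH] rfar.
  by rewrite big_nil !hornerC mulr1.
rewrite !big_cons !hornerM !normrM exprS mulrACA !hornerXsubC.
apply: ler_pM => //; last by apply: IH => y yr; apply: rfar; rewrite inE yr orbT.
have ax := rfar x (mem_head _ _).
have -> : t - x = (a - x) + (t - a) by ring.
rewrite (le_trans (ler_normD _ _)) // mulrDr mulr1 lerD2l.
by rewrite mulrA ler_pdivlMr // mulrC ler_wpM2r.
Qed.

(** As s tends to 0, (H s).[a] tends to (H 0).[a] = 0, whereas (H s).[t]
    tends to (H 0).[t] != 0 for a suitable fixed t.  By [horner_no_close_root]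
    this is impossible if H s has no root near a.  The convention 0 ^+ 0 = 1
    makes H 0 the sum of the terms with e i = 0. *)
Lemma exists_close_root (I : Type) (r : seq I) (c : I -> C) (e k : I -> nat) (a eps : C) :
  let H s := \sum_(i <- r) (c i * s ^+ e i) *: 'X^(k i) in
  H 0 != 0 -> root (H 0) a -> 0 < eps ->
  exists s t, [/\ s != 0, `|s| < eps, `|t - a| < eps & root (H s) t].
Proof.
move=> H H0 Ha eps0.
have HE s t : (H s).[t] = \sum_(i <- r) c i * s ^+ e i * t ^+ k i.
  by rewrite horner_sum; apply: eq_bigr => i _; rewrite hornerZ hornerXn.
pose K t := \sum_(i <- r) `|c i * t ^+ k i|.
have K0 t : 0 <= K t by apply: sumr_ge0.
have HK s t : `|s| <= 1 -> `|(H s).[t] - (H 0).[t]| <= `|s| * K t.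
  move=> s1; rewrite !HE -sumrB mulr_sumr.
  apply: (le_trans (ler_norm_sum _ _ _)); apply: ler_sum => i _.
  have -> : c i * s ^+ e i * t ^+ k i - c i * 0 ^+ e i * t ^+ k i =
            (s ^+ e i - 0 ^+ e i) * (c i * t ^+ k i) by ring.
  rewrite normrM ler_wpM2r //.
  case: (e i) => [|j]; first by rewrite !expr0 subrr normr0.
  by rewrite expr0n subr0 normrX exprS ler_piMr // exprn_ile1.
have [t Ht] : exists t, (H 0).[t] != 0.
  by have /closed_nonrootP[t] := H0; exists t.
pose L := (\sum_(i <- r) k i)%N.
have sH s : (size (H s) <= L.+1)%N.
  rewrite /H /L; elim: (r) => [|i r' IH]; first by rewrite !big_nil size_poly0.
  rewrite !big_cons (leq_trans (size_polyD _ _)) // geq_max; apply/andP; split.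
    by rewrite (leq_trans (size_scale_leq _ _)) // size_polyXn ltnS leq_addr.
  by rewrite (leq_trans IH) // ltnS leq_addl.
pose W := (1 + `|t - a| / eps) ^+ L.
have W0 : 0 <= W by rewrite exprn_ge0 // addr_ge0 // divr_ge0 // ltW.
pose h := `|(H 0).[t]|; have h0 : 0 < h by rewrite normr_gt0.
(* With s = 1 / Q, s is at most 1 and less than eps, and the errors in the
   values at a and t stay below a quarter of h. *)
pose Q := 1 + 2 / eps + (4 * (K a * W) / h + 4 * K t / h).
have T1 : 0 <= 2 / eps by rewrite divr_ge0 // ltW.
have T2 : 0 <= 4 * (K a * W) / h by rewrite divr_ge0 ?mulr_ge0 // ltW.
have T3 : 0 <= 4 * K t / h by rewrite divr_ge0 ?mulr_ge0 // ltW.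
have Q0 : 0 < Q by rewrite ltr_pwDl ?addr_ge0 // ltr_pwDl.
pose s := Q^-1.
have s0 : 0 < s by rewrite invr_gt0.
have sn : `|s| = s by rewrite gtr0_norm.
have s1 : s <= 1 by rewrite invf_le1 // /Q -addrA lerDl !addr_ge0.
have seps : s < eps.
  rewrite -[eps]invrK ltf_pV2 ?posrE ?invr_gt0 //.
  have e2 : eps^-1 < 2 / eps by rewrite ltr_pMl ?invr_gt0 // ltr1n.
  by rewrite (lt_le_trans e2) // /Q addrAC lerDr !addr_ge0.
have sX x : 4 * x / h <= Q -> s * x <= h / 4.
  by rewrite ler_pdivrMr // => xQ; rewrite ler_pdivrMl // mulrA ler_pdivlMr // mulrC.
have sA : s * (K a * W) <= h / 4.
  apply: sX; rewrite /Q addrCA lerDl.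
  by rewrite !addr_ge0.
have sT : s * K t <= h / 4.
  apply: sX; rewrite /Q addrA lerDr.
  by rewrite !addr_ge0.
have [[u [/negPn ua ur]]|far] := pselect (exists u, ~~ ~~ (`|a - u| < eps) /\ root (H s) u).
  by exists s, u; rewrite sn gt_eqF // distrC.
have Hle : `|(H s).[t]| <= `|(H s).[a]| * W.
  apply: (horner_no_close_root t eps0 (sH s)) => x xr; apply/negP => xa.
  by apply: far; exists x; rewrite xa.
exfalso.
have A1 : `|(H s).[a]| * W <= h / 4.
  apply: le_trans sA; rewrite mulrA ler_wpM2r //.
  by have := HK s a; rewrite sn (rootP Ha) subr0; apply.
have A2 : h <= `|(H s).[t]| + h / 4.
  have := HK s t; rewrite sn => /(_ s1)/le_trans/(_ sT).
  by rewrite distrC -lerBlDl; apply: le_trans; exact: lerB_dist.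
have := le_trans A2 (lerD (le_trans Hle A1) (lexx (h / 4))).
have -> : h / 4 + h / 4 = h / 2 by field.
by rewrite ler_pdivlMr // ger_pMr // -[X in _ <= X]/(1%:R) ler_nat.
Qed.

Lemma coef_sum_monomial (I : eqType) (r : seq I) (c : I -> C) (k : I -> nat) j :
  uniq r -> {in r &, injective k} -> j \in r ->
  (\sum_(i <- r) c i *: 'X^(k i))`_(k j) = c j.
Proof.
move=> ur kinj jr; rewrite coef_sum (bigD1_seq j) //= coefZ coefXn eqxx mulr1.
rewrite big_seq_cond big1 ?addr0 // => i /andP[ir ij]; rewrite coefZ coefXn.
by case: eqP => [/kinj E|]; [rewrite E ?eqxx in ij | rewrite mulr0].
Qed.

End RootContinuity.

(** * Limits *)

Section Convergence.
Variables (K : numFieldType) (T : Type) (F : set_system T).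
Context {FF : Filter F}.

Lemma cvg_exprn (u : T -> K) (a : K) k : u @ F --> a -> (fun t => u t ^+ k) @ F --> a ^+ k.
Proof.
move=> ua; elim: k => [|k IH].
  by under eq_fun do rewrite expr0; rewrite expr0; exact: cvg_cst.
by under eq_fun do rewrite exprS; rewrite exprS; exact: cvgM.
Qed.

Lemma cvg_exprz (u : T -> K) (a : K) (k : int) : a != 0 ->
  u @ F --> a -> (fun t => u t ^ k) @ F --> a ^ k.
Proof.
move=> a0 ua; case: k => k; first exact: cvg_exprn.
apply: (cvgV (f := fun t => u t ^+ k.+1)); first by rewrite expf_neq0.
exact: cvg_exprn.
Qed.

Lemma cvg_sumr (I : Type) (r : seq I) (f : I -> T -> K) (a : I -> K) :
  (forall i, f i @ F --> a i) ->
  (fun t => \sum_(i <- r) f i t) @ F --> \sum_(i <- r) a i.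
Proof.
move=> fa; elim: r => [|i r IH].
  by under eq_fun do rewrite big_nil; rewrite big_nil; exact: cvg_cst.
under eq_fun do rewrite big_cons; rewrite big_cons.
exact: (cvgD (fa i) IH).
Qed.

Lemma cvg_prodr (I : Type) (r : seq I) (f : I -> T -> K) (a : I -> K) :
  (forall i, f i @ F --> a i) ->
  (fun t => \prod_(i <- r) f i t) @ F --> \prod_(i <- r) a i.
Proof.
move=> fa; elim: r => [|i r IH].
  by under eq_fun do rewrite big_nil; rewrite big_nil; exact: cvg_cst.
under eq_fun do rewrite big_cons; rewrite big_cons.
exact: (cvgM (fa i) IH).
Qed.

End Convergence.

Section MevalLimit.
Variables (K : numFieldType) (N : nat) (T : Type) (F : set_system T).
Context {FF : ProperFilter F}.

Lemma cvg_meval (u : T -> 'I_N -> K) (a : 'I_N -> K) (p : mpoly N K) :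
  (forall i, (fun t => u t i) @ F --> a i) ->
  (fun t => meval (u t) p) @ F --> meval a p.
Proof.
move=> ua; under eq_fun do rewrite mevalE; rewrite mevalE.
apply: (cvg_sumr (f := fun m t => mcoeff m p * \prod_i u t i ^+ m i)) => m.
apply: cvgM; first exact: cvg_cst.
by apply: (cvg_prodr (f := fun i t => u t i ^+ m i)) => i; exact: cvg_exprn.
Qed.

Lemma cvg_eq_limit (u v : T -> K) (a b : K) :
  u @ F --> a -> v @ F --> b -> (\forall t \near F, u t = v t) -> a = b.
Proof.
move=> ua vb uv; have ub : u @ F --> b.
  apply: cvg_trans vb; apply: near_eq_cvg.
  by apply: filterS uv => t ->.
exact: (cvg_unique (@norm_hausdorff _ K) ua ub).
Qed.

End MevalLimit.

Local Open Scope complex_scope.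

Section ComplexAnalysis.
Variable R : realType.
Local Notation C := (cplx R).
Local Notation Re := (@complex.Re R).
Local Notation Im := (@complex.Im R).

Lemma pos_real (e : C) : 0 < e -> exists2 r : R, 0 < r & e = r%:C.
Proof.
case: e => a b; rewrite ltcE /= => /andP[/eqP b0 a0].
by exists a => //; rewrite b0.
Qed.

Lemma near_natSinv_lt (e : C) : 0 < e -> \forall k \near \oo, k.+1%:R^-1 < e.
Proof.
move=> /pos_real[r r0 ->].
have := near_infty_natSinv_lt (PosNum r0); apply: filterS => k /= kr.
by rewrite -(rmorph_nat (real_complex R)) -fmorphV ltcR.
Qed.

Lemma cvg_natSinv (u : nat -> C) (a : C) :
  (forall k, `|u k - a| < k.+1%:R^-1) -> u @ \oo --> a.
Proof.
move=> ua; apply/cvgrPdist_lt => e e0.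
apply: filterS (near_natSinv_lt e0) => k; apply: lt_trans.
by rewrite distrC.
Qed.

Lemma normc_ge_Im (z : R[i]) : `|Im z|%:C <= `|z|.
Proof.
by rewrite normc_def lecR -sqrtr_sqr ler_wsqrtr // lerDr sqr_ge0.
Qed.

Lemma normc_le_Re_Im (z : R[i]) : `|z| <= (`|Re z| + `|Im z|)%:C.
Proof.
rewrite normc_def lecR -(ler_pXn2r (n := 2)) ?nnegrE ?sqrtr_ge0 ?addr_ge0 //.
rewrite sqr_sqrtr ?addr_ge0 ?sqr_ge0 // sqrrD !real_normK ?num_real //.
by rewrite addrAC lerDl mulrn_wge0 // mulr_ge0.
Qed.

(** An ultrafilter assigns limits to all bounded sequences at once, which saves
    extracting subsequences. *)
Lemma ultra_bounded_cvg (U : set_system nat) (u : nat -> C) (M : C) :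
  UltraFilter U -> (forall k, `|u k| <= M) -> exists a : C, u @ U --> a.
Proof.
move=> UU uM.
have [B B0 MB] : exists2 B : R, 0 < B & forall k, `|u k| <= B%:C.
  have M0 := le_trans (normr_ge0 (u 0%N)) (uM 0%N).
  have [|B B0 BE] := @pos_real (M + 1); first by rewrite ltr_wpDl.
  by exists B => // k; rewrite -BE (le_trans (uM k)) // lerDl.
have real_cvg (v : nat -> R) : (forall k, `|v k| <= B) -> exists a : R, v @ U --> a.
  move=> vB; have [|a [_ va]] := @segment_compact R (- B) B (v @ U) _.
    rewrite /fmap /nbhs /=; apply: filterE => k /=; rewrite in_itv /= -ler_norml.
    exact: vB.
  exists a => V nV; have [//|nUV] := in_ultra_setVsetC (v @^-1` V) UU.
  have [] := va (~` V) V nUV nV.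
  by move=> y [].
have ReB k : `|Re (u k)| <= B.
  by rewrite -lecR (le_trans _ (MB k)) // normc_ge_Re.
have ImB k : `|Im (u k)| <= B.
  by rewrite -lecR (le_trans _ (MB k)) // normc_ge_Im.
have [a ra] := real_cvg _ ReB; have [b ib] := real_cvg _ ImB.
exists (a +i* b); apply/cvgrPdist_le => e e0.
have [r r0 ->] := pos_real e0.
have r20 : 0 < r / 2 by rewrite divr_gt0.
move/cvgrPdist_le/(_ _ r20) in ra; move/cvgrPdist_le/(_ _ r20) in ib.
apply: filterS2 ra ib => k ka kb.
have := normc_le_Re_Im ((a +i* b) - u k); case: (u k) ka kb => c d /= ka kb.
move=> /le_trans; apply; rewrite lecR (splitr r); exact: lerD.
Qed.

End ComplexAnalysis.

(** * The lattice points of the cone over the Newton polytope *)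

Section ConvexHull.
Variables (R : realType) (M : lmodType R).

Lemma convex_set_sum (A : set (convex_lmodType M)) (T : eqType) (r : seq T)
    (l : T -> R) (f : T -> M) :
  convex_set A -> (forall t, t \in r -> A (f t)) -> (forall t, 0 <= l t) ->
  0 < \sum_(t <- r) l t ->
  A ((\sum_(t <- r) l t)^-1 *: \sum_(t <- r) l t *: f t).
Proof.
move=> cA Af l0; elim: r Af => [|t r IH] Af; first by rewrite big_nil ltxx.
rewrite !big_cons.
have r0 : 0 <= \sum_(j <- r) l j by apply: sumr_ge0.
have At : A (f t) by apply: Af; rewrite mem_head.
have := r0; rewrite le_eqVlt => /predU1P[/esym r00|rpos] lpos.
  have l00 j : j \in r -> l j = 0.
    by move=> jr; apply/eqP; move/eqP: r00; rewrite psumr_eq0 // => /allP/(_ j jr).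
  rewrite r00 addr0 [X in _ *: (_ + X)]big1_seq; last first.
    by move=> j /= jr; rewrite l00 // scale0r.
  move: lpos; rewrite r00 !addr0 => lpos.
  by rewrite scalerA mulVf ?gt_eqF // scale1r.
have {}IH := IH (fun j jr => Af j (mem_behead (s := t :: r) jr)) rpos.
set s := \sum_(j <- r) l j in lpos rpos IH r0 *; set w := \sum_(j <- r) _ in IH *.
have p0 : 0 <= l t / (l t + s) by rewrite divr_ge0 ?addr_ge0.
have p1 : l t / (l t + s) <= 1 by rewrite ler_pdivrMr // mul1r lerDl.
have pP : Itv.spec (Itv.num_sem (R:=R)) (Itv.Real `[0%Z, 1%Z]) (l t / (l t + s)).
  by rewrite /= /Itv.num_sem /= in_itv /= p0 p1 ger0_real.
pose p : {i01 R} := Itv.mk pP.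
have := cA (f t) (s^-1 *: w) p (mem_set At) (mem_set IH) => /set_mem.
congr (A _); rewrite /conv /= /unstable.onem.
have ls0 : l t + s != 0 by rewrite gt_eqF.
have -> : 1 - l t / (l t + s) = s / (l t + s).
  by rewrite -[X in X - _](mulfV ls0) -mulrBl addrAC subrr add0r.
by rewrite scalerDr !scalerA (mulrC (l t)) mulrAC mulfV ?gt_eqF // mul1r.
Qed.

End ConvexHull.

Section ConeSemigroup.
Variables (R : realType) (n : nat) (P : mpoly n (cplx R)).
Local Notation D := (newton_polytope P).
Local Notation rexp := (@real_exponent R n).
Local Notation S := (cone_semigroup D).
Local Notation lattice := 'rV[int]_n.

Definition exponent_point (m : multinom n) : nat * lattice := (1%N, exponent m).

Lemma exponent_newton_polytope m : m \in msupp P -> D (rexp m).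
Proof. by move=> mP A [_ GA]; apply: GA; exists m. Qed.

Lemma newton_polytopeP x : D x <-> exists2 l : multinom n -> R, forall m, 0 <= l m &
  \sum_(m <- msupp P) l m = 1 /\ x = \sum_(m <- msupp P) l m *: rexp m.
Proof.
split; last first.
  move=> [l l0 [l1 ->]] A [cA GA].
  have := @convex_set_sum _ _ A _ (msupp P) l rexp cA.
  rewrite l1 invr1 scale1r; apply => //.
  by move=> m mP; apply: GA; exists m.
pose W : set (convex_lmodType 'rV[R]_n) :=
  [set x | exists2 l : multinom n -> R, forall m, 0 <= l m &
  \sum_(m <- msupp P) l m = 1 /\ x = \sum_(m <- msupp P) l m *: rexp m].
suff : D `<=` W by apply.
apply: smallest_sub => [|_ [m mP <-]].
  move=> u v p /set_mem[l l0 [l1 ->]] /set_mem[k k0 [k1 ->]]; apply/mem_set.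
  exists (fun m => p%:num * l m + (1 - p%:num) * k m).
    by move=> m; rewrite addr_ge0 // mulr_ge0 // subr_ge0.
  split; first by rewrite big_split -!mulr_sumr l1 k1 /= !mulr1 addrC subrK.
  rewrite /conv /= !scaler_sumr -big_split; apply: eq_bigr => m _ /=.
  by rewrite !scalerA -scalerDl.
exists (fun m' => (m' == m)%:R) => //; split.
  rewrite (bigD1_seq m) //= ?msupp_uniq // eqxx big1 ?addr0 // => j /negbTE ->//.
rewrite (bigD1_seq m) //= ?msupp_uniq // eqxx big1 ?addr0 ?scale1r //.
by move=> j /negbTE ->; rewrite scale0r.
Qed.

Lemma cone_semigroupP s : msupp P != [::] ->
  S s <-> exists2 c : multinom n -> R, forall m, 0 <= c m &
   \sum_(m <- msupp P) c m = s.1%:R /\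
   map_mx intr s.2 = \sum_(m <- msupp P) c m *: rexp m.
Proof.
move=> P0; split.
  move=> [x /newton_polytopeP[l l0 [l1 ->]] sE].
  exists (fun m => s.1%:R * l m); first by move=> m; rewrite mulr_ge0.
  rewrite -mulr_sumr l1 mulr1 sE scaler_sumr; split=> //.
  by apply: eq_bigr => m _; rewrite scalerA.
move=> [c c0 [c1 sE]]; have [s0|s0] := eqVneq s.1 0%N.
  have cm m : m \in msupp P -> c m = 0.
    move=> mP; apply/eqP; move: c1; rewrite s0 => /eqP.
    by rewrite psumr_eq0 // => /allP/(_ m mP).
  have [m mP] : exists m, m \in msupp P.
    by case: (msupp P) P0 => // m r _; exists m; rewrite mem_head.
  exists (rexp m).
    exact: exponent_newton_polytope.
  rewrite s0 scale0r sE big1_seq // => m' /= m'P.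
  by rewrite cm // scale0r.
have s0' : s.1%:R != 0 :> R by rewrite pnatr_eq0.
exists (s.1%:R^-1 *: map_mx intr s.2); last by rewrite scalerA mulfV // scale1r.
apply/newton_polytopeP; exists (fun m => s.1%:R^-1 * c m).
  by move=> m; rewrite mulr_ge0 ?invr_ge0.
rewrite -mulr_sumr c1 mulVf // sE scaler_sumr; split=> //.
by apply: eq_bigr => m _; rewrite scalerA.
Qed.

Lemma cone_semigroup_nonempty s : S s -> msupp P != [::].
Proof.
case=> x /newton_polytopeP[l l0 [l1 _]] _; apply: contraTneq isT => P0.
by move: l1; rewrite P0 big_nil => /esym/eqP; rewrite oner_eq0.
Qed.

Lemma cone_semigroup0 : msupp P != [::] -> S 0.
Proof.
move=> P0; apply/cone_semigroupP => //; exists (fun=> 0) => //.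
rewrite big1 //; split=> //; rewrite big1 => [|m _]; last by rewrite scale0r.
by apply/rowP => i; rewrite !mxE.
Qed.

Lemma cone_semigroupD s t : S s -> S t -> S (s + t).
Proof.
move=> Ss; have P0 := cone_semigroup_nonempty Ss; move: Ss.
move=> /(cone_semigroupP _ P0)[c c0 [c1 sE]] /(cone_semigroupP _ P0)[d d0 [d1 tE]].
apply/cone_semigroupP => //; exists (fun m => c m + d m).
  by move=> m; rewrite addr_ge0.
rewrite big_split /= c1 d1 -natrD; split=> //.
under eq_bigr do rewrite scalerDl.
by rewrite big_split /= -sE -tE -map_mxD.
Qed.

Lemma cone_semigroupMn s k : S s -> S (s *+ k).
Proof.
move=> Ss; elim: k => [|k IH]; last by rewrite mulrS; exact: cone_semigroupD.
by rewrite mulr0n; apply: cone_semigroup0; exact: cone_semigroup_nonempty Ss.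
Qed.

Lemma real_exponentE m : map_mx intr (exponent m) = rexp m.
Proof. by apply/rowP => i; rewrite !mxE -pmulrn. Qed.

Lemma exponent_point_in_cone m : m \in msupp P -> S (exponent_point m).
Proof.
move=> mP; exists (rexp m); first exact: exponent_newton_polytope.
by rewrite scale1r real_exponentE.
Qed.

Lemma pair_sum1 (I : Type) (r : seq I) (Q : pred I) (f : I -> nat * lattice) :
  (\sum_(i <- r | Q i) f i).1 = (\sum_(i <- r | Q i) (f i).1)%N.
Proof. exact: (big_morph (fun s => s.1)). Qed.

Lemma pair_sum2 (I : Type) (r : seq I) (Q : pred I) (f : I -> nat * lattice) :
  (\sum_(i <- r | Q i) f i).2 = \sum_(i <- r | Q i) (f i).2.
Proof. exact: (big_morph (fun s => s.2)). Qed.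

Lemma pair_mulrn (s : nat * lattice) k : s *+ k = ((s.1 * k)%N, s.2 *+ k).
Proof.
elim: k => [|k IH]; first by rewrite !mulr0n muln0.
by rewrite !mulrS IH mulnS.
Qed.

Lemma pair_ext (s t : nat * lattice) : s.1 = t.1 -> s.2 = t.2 -> s = t.
Proof. by case: s => ? ?; case: t => ? ? /= -> ->. Qed.

Lemma cone_semigroup_sub s (q : multinom n -> nat) (c : multinom n -> R) :
  msupp P != [::] -> (forall m, 0 <= c m) ->
  \sum_(m <- msupp P) c m = s.1%:R ->
  map_mx intr s.2 = \sum_(m <- msupp P) c m *: rexp m ->
  (forall m, (q m)%:R <= c m) ->
  exists r, [/\ S r, s = \sum_(m <- msupp P) exponent_point m *+ q m + r,
    r.1%:R = \sum_(m <- msupp P) (c m - (q m)%:R) &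
    map_mx intr r.2 = \sum_(m <- msupp P) (c m - (q m)%:R) *: rexp m].
Proof.
move=> P0 c0 c1 sE qc; set v := \sum_(m <- _) _.
have v1 : v.1 = (\sum_(m <- msupp P) q m)%N.
  by rewrite pair_sum1; apply: eq_bigr => m _; rewrite pair_mulrn mul1n.
have v2 : v.2 = \sum_(m <- msupp P) exponent m *+ q m.
  by rewrite pair_sum2; apply: eq_bigr => m _; rewrite pair_mulrn.
have vs : (v.1 <= s.1)%N.
  by rewrite -(ler_nat R) -c1 v1 natr_sum; apply: ler_sum.
pose r : nat * lattice := ((s.1 - v.1)%N, s.2 - v.2).
have r1 : r.1%:R = \sum_(m <- msupp P) (c m - (q m)%:R).
  by rewrite sumrB /= natrB // -c1 v1 natr_sum.
have r2 : map_mx intr r.2 = \sum_(m <- msupp P) (c m - (q m)%:R) *: rexp m.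
  rewrite map_mxB sE v2 raddf_sum /= -sumrB; apply: eq_bigr => m _.
  by rewrite scalerBl raddfMn /= real_exponentE scaler_nat.
exists r; split=> //; last first.
  by apply: pair_ext => /=; [exact/esym/subnKC | exact/esym/subrKC].
by apply/cone_semigroupP => //; exists (fun m => c m - (q m)%:R) => // m; rewrite subr_ge0.
Qed.

Lemma cone_semigroup_degree0 s : S s -> s.1 = 0%N -> s = 0.
Proof.
move=> [x _ sE] s0; apply: pair_ext => //; apply/rowP => i.
move: sE => /rowP/(_ i); rewrite s0 scale0r !mxE => /eqP.
by rewrite intr_eq0 => /eqP.
Qed.

(** Gordan's lemma.  Write a point of the cone as a combination of exponent
    points with nonnegative real coefficients and split off the integral parts of
    the coefficients: the rest lies in a bounded box. *)
Lemma gordan : exists (K : nat) (b : 'I_K -> nat * lattice),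
  (forall i, S (b i) /\ (0 < (b i).1)%N) /\
  forall s, S s -> exists a : 'I_K -> nat, s = \sum_i b i *+ a i.
Proof.
have [P0|P0] := eqVneq (msupp P) [::].
  exists 0%N, (fun=> 0); split=> [[]//|s /cone_semigroup_nonempty].
  by rewrite P0.
pose M := (\sum_(m <- msupp P) mdeg m)%N.
pose box : seq (nat * lattice) := [seq (k, \row_i ((g : {ffun 'I_n -> 'I_M.+1}) i : nat)%:Z)
  | k <- iota 1 (size (msupp P)), g <- enum {ffun 'I_n -> 'I_M.+1}].
pose B := [seq exponent_point m | m <- msupp P] ++ [seq s <- box | `[< S s >]].
pose b (i : 'I_(size B)) := nth (0 : nat * lattice) B i.
have bS i : S (b i) /\ (0 < (b i).1)%N.
  have : b i \in B by rewrite mem_nth.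
  rewrite mem_cat mem_filter => /orP[/mapP[m mP ->]|/andP[/asboolP Sb bbox]].
    by split=> //; exact: exponent_point_in_cone.
  split=> //; move: bbox; case/allpairsP => -[k g] /= [kI _ ->] /=.
  by move: kI; rewrite mem_iota => /andP[].
exists (size B), b; split=> // s Ss.
pose gen t := exists a : 'I_(size B) -> nat, t = \sum_i b i *+ a i.
have genD t u : gen t -> gen u -> gen (t + u).
  move=> [a1 ->] [a2 ->]; exists (fun i => a1 i + a2 i)%N.
  by rewrite -big_split; apply: eq_bigr => i _; rewrite mulrnDr.
have gen0 : gen 0 by exists (fun=> 0%N); rewrite big1.
have genB t : t \in B -> gen t.
  move=> tB; have tB' : (index t B < size B)%N by rewrite index_mem.
  exists (fun i => (i == Ordinal tB') : nat).
  rewrite (bigD1 (Ordinal tB')) //= eqxx mulr1n big1 ?addr0 ?/b ?nth_index //.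
  by move=> i /negbTE ->.
have genMn t k : gen t -> gen (t *+ k).
  by move=> gt; elim: k => [|k IH]; rewrite ?mulr0n ?mulrS //; exact: genD.
move/(cone_semigroupP _ P0): (Ss) => [c c0 [c1 sE]].
pose q m := Num.truncn (c m).
have qc m : (q m)%:R <= c m by rewrite truncn_le.
have cq m : c m - (q m)%:R <= 1.
  by rewrite lerBlDr addrC natr1 ltW // truncnS_gt.
have [r [Sr -> r1 r2]] := cone_semigroup_sub P0 c0 c1 sE qc.
apply: (genD).
  rewrite big_seq; apply: (big_ind gen gen0 genD) => m mP; apply: genMn.
  by apply: genB; rewrite mem_cat map_f.
have [r0|r0] := posnP r.1; first by rewrite (cone_semigroup_degree0 Sr r0).
apply: genB; rewrite mem_cat mem_filter; apply/orP; right; apply/andP; split.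
  exact/asboolP.
have rge0 i : 0 <= r.2 0 i.
  have /rowP/(_ i) := r2; rewrite mxE summxE => E.
  rewrite -(ler0z R) E sumr_ge0 // => m _.
  by rewrite !mxE mulr_ge0 // subr_ge0.
have rle i : (absz (r.2 0%R i) <= M)%N.
  rewrite -(ler_nat R) pmulrn gez0_abs //.
  have /rowP/(_ i) := r2; rewrite mxE summxE => ->.
  rewrite natr_sum; apply: ler_sum => m _.
  rewrite !mxE; apply: (@le_trans _ _ (m i)%:R).
    by rewrite ler_piMl.
  by rewrite ler_nat mdegE (bigD1 i) //= leq_addr.
apply/allpairsP; exists (r.1, [ffun i => inord `|r.2 0 i|]) => /=; split.
- rewrite mem_iota r0 add1n ltnS -(ler_nat R) r1 -sum1_size natr_sum.
  exact: ler_sum.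
- by rewrite mem_enum.
- apply: pair_ext => //; apply/rowP => i.
  by rewrite mxE ffunE inordK ?ltnS // gez0_abs.
Qed.

(** For k large, the combination of exponent points that represents s *+ k has
    a coefficient at least 1, and that exponent point can be subtracted. *)
Lemma cone_semigroup_mulrn s : S s -> (0 < s.1)%N ->
  exists k m t, [/\ m \in msupp P, S t & s *+ k = exponent_point m + t].
Proof.
move=> Ss s0; have P0 := cone_semigroup_nonempty Ss.
move/(cone_semigroupP _ P0): (Ss) => [c c0 [c1 sE]].
have [m mP cm] : exists2 m, m \in msupp P & 0 < c m.
  apply: contrapT => H; suff : s.1%:R <= 0 :> R by rewrite lern0 eqn0Ngt s0.
  rewrite -c1 big_seq; apply: sumr_le0 => m mP; rewrite leNgt; apply/negP => cm.
  by apply: H; exists m.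
pose k := (Num.truncn (c m)^-1).+1.
have kc : 1 <= k%:R * c m.
  by rewrite -ler_pdivrMr // div1r ltW // truncnS_gt.
have := @cone_semigroup_sub (s *+ k) (fun m' => (m' == m) : nat) (fun m => k%:R * c m) P0.
case.
- by move=> m'; rewrite mulr_ge0.
- by rewrite -mulr_sumr c1 pair_mulrn /= mulnC natrM.
- rewrite pair_mulrn /= raddfMn /= sE -scaler_nat scaler_sumr.
  by apply: eq_bigr => j _; rewrite scalerA.
- by move=> j; have [->|_] := eqVneq j m; rewrite ?mulr_ge0.
move=> r [Sr sr _ _]; exists k, m, r; split=> //.
rewrite sr; congr (_ + _).
by rewrite (bigD1_seq m) //= ?msupp_uniq // eqxx big1 ?addr0 // => j /negbTE ->.
Qed.

End ConeSemigroup.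

(** * Homogeneous coordinates of the toric variety *)

Section ConePoints.
Variables (R : realType) (n : nat) (D : set 'rV[R]_n).
Local Notation C := (cplx R).
Local Notation S := (cone_semigroup D).
Local Notation lattice := 'rV[int]_n.

Lemma to_Tor_eq (x y : cone_points D) :
  to_Tor x = to_Tor y <->
  exists2 c : C, c != 0 & forall s, set_val y s = c ^+ s.1 * set_val x s.
Proof.
rewrite /to_Tor; split=> [/eqmodP|H]; first by move/asboolP.
by apply/eqmodP/asboolP.
Qed.

Lemma repr_Tor (p : Tor D) : to_Tor (repr p) = p.
Proof. exact: reprK. Qed.

Lemma cone_point1 (x : cone_points D) : set_val x 0 = 1.
Proof. by have [] := set_mem (valP x). Qed.

Lemma cone_pointD (x : cone_points D) s t : S s -> S t ->
  set_val x (s + t) = set_val x s * set_val x t.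
Proof. by have [_ H _ _] := set_mem (valP x); exact: H. Qed.

Lemma cone_point_out (x : cone_points D) s : ~ S s -> set_val x s = 0.
Proof. by have [_ _ H _] := set_mem (valP x); exact: H. Qed.

Lemma cone_point_neq0 (x : cone_points D) :
  exists2 s, S s & (0 < s.1)%N /\ set_val x s != 0.
Proof. by have [] := set_mem (valP x). Qed.

Lemma cone_point_cvg (T : Type) (F : set_system T) (f : T -> cone_points D) (x : cone_points D) :
  Filter F -> (forall s, (fun t => set_val (f t) s) @ F --> set_val x s) ->
  f @ F --> x.
Proof.
move=> FF fx U [_ [[W oW <-] Wx WU]].
have cv : (fun t => set_val (f t)) @ F --> (set_val x : {ptws (nat * lattice) -> C}).
  apply/cvg_sup => s A [_ [[V oV <-] Vx VA]].
  have : nbhs (set_val x s) V by apply: open_nbhs_nbhs; split.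
  by move=> /(fx s); rewrite /nbhs /=; apply: filterS => t; exact: VA.
have : nbhs (set_val x : {ptws (nat * lattice) -> C}) W by apply: open_nbhs_nbhs; split.
by move=> /cv; rewrite /nbhs /=; apply: filterS => t; exact: WU.
Qed.

Lemma cone_point_coord_continuous s : continuous (fun x : cone_points D => set_val x s : C).
Proof.
move=> x A nA.
have H : nbhs (set_val x : prod_topology (fun _ : nat * lattice => C)) (proj s @^-1` A).
  exact: (@proj_continuous _ (fun _ : nat * lattice => C) s).
exact: (@initial_continuous _ _ (set_val : cone_points D -> _) x _ H).
Qed.

End ConePoints.

Section Embedding.
Variables (R : realType) (n : nat).
Local Notation C := (cplx R).
Local Notation lattice := 'rV[int]_n.

(** Z x Z^n as a single lattice, so that a scalar c and a point z of the torus
    together act through one monomial, see [monomial_row_mx]. *)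
Definition lattice_point (s : nat * lattice) : 'rV[int]_(1 + n) :=
  row_mx (s.1%:Z)%:M s.2.

Lemma lattice_point0 : lattice_point 0 = 0.
Proof. by rewrite /lattice_point /= raddf0 row_mx0. Qed.

Lemma lattice_pointD s t : lattice_point (s + t) = lattice_point s + lattice_point t.
Proof. by rewrite /lattice_point add_row_mx -raddfD /= -PoszD. Qed.

Lemma lattice_pointMn s k : lattice_point (s *+ k) = lattice_point s *+ k.
Proof.
by elim: k => [|k IH]; rewrite ?mulr0n ?lattice_point0 // !mulrS lattice_pointD IH.
Qed.

Lemma lattice_point_sum (I : Type) (r : seq I) (Q : pred I) f :
  lattice_point (\sum_(i <- r | Q i) f i) = \sum_(i <- r | Q i) lattice_point (f i).
Proof. exact: (big_morph _ lattice_pointD lattice_point0). Qed.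

Lemma lattice_point_inj : injective lattice_point.
Proof.
move=> s t /eq_row_mx[/rowP/(_ 0) + E]; rewrite !mxE !eqxx !mulr1n => -[E'].
exact: pair_ext.
Qed.

Lemma monomial_row_mx (c : C) (z : 'rV[C]_n) s :
  monomial (row_mx c%:M z) (lattice_point s) = c ^+ s.1 * monomial z s.2.
Proof.
rewrite /monomial big_split_ord -[LHS]/(_ * _); congr (_ * _).
  by rewrite big_ord1 /lattice_point !row_mxEl !mxE !mulr1n.
by apply: eq_bigr => i _; rewrite /lattice_point !row_mxEr.
Qed.

Lemma monomial_exponent (z : 'rV[C]_n) m : monomial z (exponent m) = \prod_i z 0 i ^+ m i.
Proof. by apply: eq_bigr => i _; rewrite mxE. Qed.

End Embedding.

Section Density.
Variables (R : realType) (n : nat) (P : mpoly n (cplx R)).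
Local Notation C := (cplx R).
Local Notation D := (newton_polytope P).
Local Notation S := (cone_semigroup D).
Local Notation lattice := 'rV[int]_n.

(** The section F of O(1) that P defines, in homogeneous coordinates. *)
Definition equation_section (x : nat * lattice -> C) : C :=
  \sum_(m <- msupp P) mcoeff m P * x (exponent_point m).

(** The sections G_i of O(1) that restrict to the logarithmic derivatives of P,
    in homogeneous coordinates. *)
Definition gradient_section (x : nat * lattice -> C) : 'rV[C]_n :=
  \row_i \sum_(m <- msupp P) mcoeff m P * (m i)%:R * x (exponent_point m).

Lemma cone_point_nonempty (x : cone_points D) : msupp P != [::].
Proof. by have [s /cone_semigroup_nonempty] := cone_point_neq0 x. Qed.

Lemma cone_pointMn (x : cone_points D) s k : S s -> set_val x (s *+ k) = set_val x s ^+ k.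
Proof.
move=> Ss; elim: k => [|k IH]; first by rewrite mulr0n cone_point1.
by rewrite mulrS exprS cone_pointD ?IH //; exact: cone_semigroupMn.
Qed.

Lemma cone_semigroup_sum (I : Type) (r : seq I) (Q : pred I) (f : I -> nat * lattice) :
  msupp P != [::] -> (forall i, S (f i)) -> S (\sum_(i <- r | Q i) f i).
Proof.
move=> P0 Sf; apply: (big_ind S) => [|s t|//]; first exact: cone_semigroup0.
exact: cone_semigroupD.
Qed.

Lemma cone_point_sum (x : cone_points D) (I : Type) (r : seq I) (Q : pred I)
    (f : I -> nat * lattice) : (forall i, S (f i)) ->
  set_val x (\sum_(i <- r | Q i) f i) = \prod_(i <- r | Q i) set_val x (f i).
Proof.
move=> Sf; elim: r => [|i r IH]; first by rewrite !big_nil cone_point1.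
rewrite !big_cons; case: ifP => // _; rewrite cone_pointD ?IH //.
by apply: cone_semigroup_sum => //; exact: cone_point_nonempty x.
Qed.

(** By [cone_semigroup_mulrn], some power of a nonzero coordinate of positive
    degree is a multiple of a coordinate at an exponent point. *)
Lemma cone_point_exponent_neq0 (x : cone_points D) :
  exists2 m, m \in msupp P & set_val x (exponent_point m) != 0.
Proof.
have [s Ss [s0 xs]] := cone_point_neq0 x.
have [k [m [t [mP St E]]]] := cone_semigroup_mulrn Ss s0.
exists m => //; have := expf_neq0 k xs; rewrite -cone_pointMn // E cone_pointD //.
  by rewrite mulf_eq0 negb_or => /andP[].
exact: exponent_point_in_cone.
Qed.

Definition torus_cone_fun (w : 'rV[C]_(1 + n)) : {ptws (nat * lattice) -> C} :=
  fun s => if `[< S s >] then monomial w (lattice_point s) else 0.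

Lemma torus_cone_subproof (w : 'rV[C]_(1 + n)) : msupp P != [::] -> torus w ->
  torus_cone_fun w \in cone_points D.
Proof.
move=> P0 wT; have E s : S s -> torus_cone_fun w s = monomial w (lattice_point s).
  by move=> Ss; rewrite /torus_cone_fun asboolT.
apply/mem_set; split.
- by rewrite E ?lattice_point0 ?monomial0 //; exact: cone_semigroup0.
- move=> s t Ss St; rewrite !E ?lattice_pointD ?monomialD //.
  exact: cone_semigroupD.
- by move=> s nSs; rewrite /torus_cone_fun asboolF.
- have [m mP] : exists m, m \in msupp P.
    by case: (msupp P) P0 => // m r _; exists m; rewrite mem_head.
  have Sm := exponent_point_in_cone mP.
  by exists (exponent_point m) => //; split=> //; rewrite E // monomial_neq0.
Qed.

Definition torus_cone w (P0 : msupp P != [::]) (wT : torus w) : cone_points D :=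
  exist (fun y => y \in cone_points D) _ (torus_cone_subproof P0 wT).

Lemma torus_coneE w P0 wT s : S s ->
  set_val (@torus_cone w P0 wT) s = monomial w (lattice_point s).
Proof.
move=> Ss; rewrite -[LHS]/(torus_cone_fun w s) /torus_cone_fun.
by rewrite asboolT.
Qed.

Lemma torus_row_mx (c : C) (z : 'rV[C]_n) :
  torus (row_mx c%:M z) <-> c != 0 /\ torus z.
Proof.
split=> [H|[c0 zT] i].
  split=> [|i]; first by have := H (lshift n 0); rewrite row_mxEl mxE mulr1n.
  by have := H (rshift 1 i); rewrite row_mxEr.
case: (split_ordP i) => j ->; rewrite ?row_mxEl ?row_mxEr ?zT //.
by rewrite mxE (ord1 j) mulr1n.
Qed.

Lemma equation_section_torus (c : C) (z : 'rV[C]_n) :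
  equation_section (fun s => c ^+ s.1 * monomial z s.2) = c * meval (z 0) P.
Proof.
rewrite mevalE mulr_sumr; apply: eq_bigr => m _.
by rewrite monomial_exponent mulrCA.
Qed.

Lemma Tor_of_torus_cone (c : C) (z : 'rV[C]_n) P0 (wT : torus (row_mx c%:M z)) :
  Tor_of_torus z (to_Tor (torus_cone P0 wT)).
Proof.
have /torus_row_mx[c0 zT] := wT.
have w1T : torus (row_mx (1 : C)%:M z) by apply/torus_row_mx; rewrite oner_neq0.
exists (torus_cone P0 w1T).
  apply/esym/to_Tor_eq; exists c => // s.
  have [Ss|nSs] := pselect (S s); last by rewrite !cone_point_out ?mulr0.
  by rewrite !torus_coneE // !monomial_row_mx expr1n mul1r.
by move=> s Ss; rewrite torus_coneE // monomial_row_mx expr1n mul1r.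
Qed.

(** The support of x is a face of the semigroup.  There x is a character, which
    extends to a point w of the torus; the functional l is positive off the face
    and vanishes on it.  Since 0 ^+ k is 1 if k = 0 and 0 otherwise, the equation
    for x says that x is the value at s = 0 of the curve w s^l. *)
Lemma cone_point_orbit (x : cone_points D) :
  exists (w : 'rV[C]_(1 + n)) (l : 'rV[int]_(1 + n)), torus w /\
  forall s, S s -> exists2 k : nat, dotv l (lattice_point s) = k%:Z &
    set_val x s = monomial w (lattice_point s) * 0 ^+ k.
Proof.
have P0 := cone_point_nonempty x.
pose Phi : set 'rV[int]_(1 + n) :=
  [set u | exists2 s, S s /\ set_val x s != 0 & u = lattice_point s].
(* [lattice_point] is injective; on its image, chi is x. *)
pose chi (u : 'rV[int]_(1 + n)) : C := set_val x (absz (u 0 (lshift n 0)), rsubmx u).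
have chiE s : chi (lattice_point s) = set_val x s.
  rewrite /chi /lattice_point row_mxEl mxE mulr1n row_mxKr absz_nat.
  by congr (set_val x _); case: s.
have [w wT wE] : exists2 w : 'rV[C]_(1 + n), torus w & forall u, Phi u -> chi u = monomial w u.
  apply: character_monomial.
  - exists 0; last by rewrite lattice_point0.
    by rewrite cone_point1 oner_neq0; split=> //; exact: cone_semigroup0.
  - move=> _ _ [s [Ss xs] ->] [t [St xt] ->]; exists (s + t).
      by rewrite cone_pointD // mulf_neq0 //; split=> //; exact: cone_semigroupD.
    by rewrite lattice_pointD.
  - by move=> _ [s [Ss xs] ->]; rewrite chiE.
  - move=> _ _ [s [Ss xs] ->] [t [St xt] ->].
    by rewrite -lattice_pointD !chiE cone_pointD.
have [K [b [bS' bP]]] := gordan P.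
have bS i : S (b i) by case: (bS' i).
pose Ph i := set_val x (b i) != 0.
have [|l l0 lPh] := @face_functional _ _ (fun i => lattice_point (b i)) Ph.
  move=> p q E i pi0.
  have {}E : \sum_i b i *+ p i = \sum_(i | Ph i) b i *+ q i.
    apply: (@lattice_point_inj n); rewrite !lattice_point_sum.
    under eq_bigr do rewrite lattice_pointMn.
    by under [RHS]eq_bigr do rewrite lattice_pointMn.
  have SbMn k : forall i, S (b i *+ k i) by move=> j; exact: cone_semigroupMn.
  have := congr1 (set_val x) E; rewrite !cone_point_sum //.
  under eq_bigr do rewrite cone_pointMn //.
  under [RHS]eq_bigr do rewrite cone_pointMn //.
  move=> F; have : \prod_(i | Ph i) set_val x (b i) ^+ q i != 0.
    by apply/prodf_neq0 => j; exact: expf_neq0.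
  rewrite -F => /prodf_neq0/(_ i isT); apply: contra => /eqP ->.
  by rewrite expr0n gtn_eqF.
exists w, l; split=> // s Ss.
have [a sE] := bP s Ss.
have lE : dotv l (lattice_point s) = \sum_i dotv l (lattice_point (b i)) * (a i)%:R.
  rewrite sE lattice_point_sum dotvC dotv_suml; apply: eq_bigr => i _.
  by rewrite dotvC lattice_pointMn -scaler_nat dotvZr mulrC.
have ls0 : 0 <= dotv l (lattice_point s).
  by rewrite lE sumr_ge0 // => i _; rewrite mulr_ge0.
exists (absz (dotv l (lattice_point s))); first by rewrite gez0_abs.
have xsE : (set_val x s != 0) = (dotv l (lattice_point s) == 0).
  rewrite lE psumr_eq0; last by move=> i _; rewrite mulr_ge0.
  rewrite {1}sE cone_point_sum; last by move=> i; exact: cone_semigroupMn.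
  apply/idP/allP => [/prodf_neq0 H i _|H].
    have := H i isT; rewrite cone_pointMn // mulf_eq0 lPh pnatr_eq0.
    apply: contraR; rewrite negb_or negbK => /andP[/eqP-> a0].
    by rewrite expr0n (negbTE a0).
  apply/prodf_neq0 => i _; rewrite cone_pointMn //.
  have := H i; rewrite mem_index_enum mulf_eq0 lPh pnatr_eq0 => /(_ isT)/orP[|/eqP ->].
    by rewrite /Ph => ?; exact: expf_neq0.
  by rewrite expr0 oner_neq0.
have [xs0|xs0] := eqVneq (set_val x s) 0.
  by rewrite expr0n absz_eq0 -xsE xs0 eqxx mulr0.
rewrite expr0n absz_eq0 -xsE xs0 mulr1 -chiE; apply: wE.
by exists s.
Qed.

End Density.

(** * The closure of the hypersurface *)

Section OneParameter.
Variables (R : realType) (N : nat).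
Local Notation C := (cplx R).

Definition one_param (s : C) (l : 'rV[int]_N) : 'rV[C]_N := \row_i s ^ l 0 i.

Lemma torus_one_param s l : s != 0 -> torus (one_param s l).
Proof. by move=> s0 i; rewrite mxE expfz_neq0. Qed.

Lemma torus_torus_mul (z w : 'rV[C]_N) : torus z -> torus w -> torus (torus_mul z w).
Proof. by move=> zT wT i; rewrite mxE mulf_neq0. Qed.

Lemma monomial_torus_mul (z w : 'rV[C]_N) u :
  monomial (torus_mul z w) u = monomial z u * monomial w u.
Proof. by rewrite -big_split; apply: eq_bigr => i _; rewrite mxE expfzMl. Qed.

Lemma monomial_one_param s l u : s != 0 -> monomial (one_param s l) u = s ^ dotv l u.
Proof.
move=> s0; rewrite /dotv.
rewrite (big_morph (fun k : int => s ^ k) (fun k l => expfzDr k l s0) (expr0z s)).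
by apply: eq_bigr => i _; rewrite mxE exprz_exp.
Qed.

End OneParameter.

Section Closure.
Variables (R : realType) (n : nat) (P : mpoly n (cplx R)).
Local Notation C := (cplx R).
Local Notation D := (newton_polytope P).
Local Notation S := (cone_semigroup D).
Local Notation lattice := 'rV[int]_n.

(** If the i-th coordinate of the direction is K ^ i, the weight of an exponent
    is the number with the digits m i in base K, which determines the exponent
    when K exceeds all digits. *)
Lemma generic_direction : exists a : 'rV[int]_(1 + n), exists wt : multinom n -> nat,
  (forall m, dotv a (lattice_point (exponent_point m)) = (wt m)%:Z) /\
  {in msupp P &, injective wt}.
Proof.
pose K := (\sum_(m <- msupp P) mdeg m).+1.
exists (row_mx 0 (\row_i (K ^ i)%N%:Z)).
exists (fun m : multinom n => \sum_(i < n) m i * K ^ i)%N; split.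
  move=> m; rewrite /dotv big_split_ord -[LHS]/(_ + _) big1 ?add0r => [|i _]; last first.
    by rewrite row_mxEl mxE mul0r.
  rewrite (big_morph Posz PoszD (erefl 0)); apply: eq_bigr => i _.
  by rewrite /lattice_point !row_mxEr !mxE PoszM mulrC.
move=> m m' mP m'P E; apply/mnmP; apply: base_expansion_inj E.
  move=> i; rewrite /K ltnS (bigD1_seq m) ?msupp_uniq //= mdegE (bigD1 i) //=.
  by rewrite -addnA leq_addr.
move=> i; rewrite /K ltnS (bigD1_seq m') ?msupp_uniq //= mdegE (bigD1 i) //=.
by rewrite -addnA leq_addr.
Qed.

(** The curve of points w s^l t^a of the hypersurface that approaches x: with l
    and w from [cone_point_orbit] and a from [generic_direction], the equation of
    the hypersurface is H s in the unknown t.  The polynomial H 0 has the root 1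
    because F vanishes at x, and it is not zero because a separates the exponents
    and x does not vanish at all of them. *)
Lemma closure_of_equation (x : cone_points D) :
  equation_section P (set_val x) = 0 -> closure_in_Tor P (to_Tor x).
Proof.
move=> Fx; have P0 := cone_point_nonempty x.
have [w [l [wT xE]]] := cone_point_orbit x.
have [a [wt [awt wt_inj]]] := generic_direction.
pose e m := absz (dotv l (lattice_point (exponent_point m))).
have eE m : m \in msupp P -> dotv l (lattice_point (exponent_point m)) = (e m)%:Z /\
    set_val x (exponent_point m) = monomial w (lattice_point (exponent_point m)) * 0 ^+ e m.
  move=> mP; have [k kE ->] := xE _ (exponent_point_in_cone mP).
  by rewrite /e kE absz_nat.
pose c m := mcoeff m P * monomial w (lattice_point (exponent_point m)).
have cE m : m \in msupp P -> c m * 0 ^+ e m = mcoeff m P * set_val x (exponent_point m).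
  by move=> mP; have [_ ->] := eE m mP; rewrite mulrA.
pose H s : {poly C} := \sum_(m <- msupp P) (c m * s ^+ e m) *: 'X^(wt m).
have H1 : root (H 0) 1.
  rewrite rootE horner_sum -[X in _ == X]Fx; apply/eqP.
  by apply: eq_big_seq => m mP; rewrite hornerZ hornerXn expr1n mulr1 cE.
have H0 : H 0 != 0.
  have [m mP xm] := cone_point_exponent_neq0 x.
  apply/eqP => /polyP/(_ (wt m)); rewrite coef0 /H coef_sum_monomial ?msupp_uniq //.
  by rewrite cE // => /eqP; rewrite mulf_eq0 (negbTE xm) mcoeff_eq0 mP.
have curve (k : nat) : exists p : C * C,
   [/\ p.1 != 0, `|p.1| < k.+1%:R^-1, `|p.2 - 1| < k.+1%:R^-1 & root (H p.1) p.2].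
  have k0 : 0 < k.+1%:R^-1 :> C by rewrite invr_gt0 ltr0n.
  by have [s [t Hst]] := exists_close_root H0 H1 k0; exists (s, t).
have /boolp.choice[p pP] := curve.
have s0 k : (p k).1 != 0 by have [] := pP k.
have t0 k : (p k).2 != 0.
  have [_ _ + _] := pP k; apply: contraTneq => ->.
  by rewrite sub0r normrN1 le_gtF // invf_le1 ?ltr0n // ler1n.
pose v k := torus_mul w (torus_mul (one_param (p k).1 l) (one_param (p k).2 a)).
have vT k : torus (v k) by do !apply: torus_torus_mul => //; exact: torus_one_param.
have vE k u : monomial (v k) u = monomial w u * ((p k).1 ^ dotv l u * (p k).2 ^ dotv a u).
  by rewrite !monomial_torus_mul !monomial_one_param.
have cv_s : (fun k => (p k).1) @ \oo --> (0 : C).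
  by apply: cvg_natSinv => k; rewrite subr0; have [] := pP k.
have cv_t : (fun k => (p k).2) @ \oo --> (1 : C).
  by apply: cvg_natSinv => k; have [] := pP k.
pose z k := rsubmx (v k).
pose c0 k := v k 0 (lshift n 0).
have vzE k : v k = row_mx (c0 k)%:M (z k).
  rewrite -[LHS]hsubmxK; congr row_mx.
  by rewrite [LHS]mx11_scalar mxE.
have wzT k : torus (row_mx (c0 k)%:M (z k)) by rewrite -vzE.
have zP k : hypersurface P (z k).
  have /torus_row_mx[c00 zT] := wzT k; split=> //.
  suff : c0 k * meval (z k 0) P = 0.
    by move/eqP; rewrite mulf_eq0 (negbTE c00) => /eqP.
  rewrite -equation_section_torus.
  have [_ _ _ /rootP <-] := pP k; rewrite horner_sum; apply: eq_big_seq => m mP.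
  rewrite -monomial_row_mx -vzE vE hornerZ hornerXn awt; have [-> _] := eE m mP.
  by rewrite /c !mulrA.
pose y k := torus_cone P0 (wzT k).
have cv : (fun k => to_Tor (y k)) @ \oo --> to_Tor x.
  apply: (@cvg_comp _ _ _ y (@to_Tor _ _ D) _ (nbhs x)); last first.
    exact: pi_continuous.
  apply: cone_point_cvg => s; have [Ss|nSs] := pselect (S s); last first.
    have -> : (fun k => set_val (y k) s) = cst (0 : C).
      by apply/funext => k; rewrite cone_point_out.
    have x0 := cone_point_out x nSs.
    rewrite x0.
    exact: (@cvg_cst C).
  have -> : (fun k => set_val (y k) s) = (fun k => monomial w (lattice_point s) *
      ((p k).1 ^ dotv l (lattice_point s) * (p k).2 ^ dotv a (lattice_point s))).
    by apply/funext => k; rewrite torus_coneE // -vzE vE.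
  have [k kE ->] := xE s Ss; rewrite kE.
  have cvs := cvg_exprn (FF := eventually_filter) (k := k) cv_s.
  have cvt := cvg_exprz (FF := eventually_filter) (k := dotv a (lattice_point s))
    (oner_neq0 C) cv_t.
  have := @cvgM _ _ _ eventually_filter _ _ _ _ cvs cvt; rewrite exp1rz mulr1 => cvst.
  exact: (cvgM (@cvg_cst C (monomial w (lattice_point s)) _ _ _) cvst).
move=> B /cv [N _ NB]; exists (to_Tor (y N)); split; last by apply: NB => /=.
by exists (z N) => //; exact: Tor_of_torus_cone.
Qed.

End Closure.

Section TorClosure.
Variables (R : realType) (n : nat) (D : set 'rV[R]_n).
Local Notation C := (cplx R).
Local Notation lattice := 'rV[int]_n.

Lemma Tor_coordE (x : cone_points D) :
  exists2 c : C, c != 0 & forall s, Tor_coord (to_Tor x) s = c ^+ s.1 * set_val x s.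
Proof.
have /to_Tor_eq[c c0 H] : to_Tor x = to_Tor (repr (to_Tor x)) by rewrite repr_Tor.
by exists c.
Qed.

Definition scale_cone (c : C) (x : nat * lattice -> C) s := c ^+ s.1 * x s.

Lemma form_eval_scale d a (c : C) (x : nat * lattice -> C) :
  form_eval d a (scale_cone c x) = c ^+ d * form_eval d a x.
Proof.
by rewrite /form_eval mulr_sumr; apply: eq_bigr => u _; rewrite mulrCA.
Qed.

Lemma form_eval_continuous d a :
  continuous (fun x : cone_points D => form_eval d a (set_val x)).
Proof.
move=> x; rewrite /form_eval /continuous_at.
apply: (cvg_sumr (FF := nbhs_filter x)
  (f := fun u (x : cone_points D) => u.1 * set_val x (d, u.2))) => u.
exact: (@cvgM _ _ _ (nbhs_filter x) _ _ _ _ (cvg_cst _)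
  (@cone_point_coord_continuous _ _ _ _ x)).
Qed.

(** Whether E vanishes at the homogeneous coordinates of a point does not
    depend on the choice of the coordinates, so E != 0 defines an open set. *)
Lemma closure_nonvanishing (A : set (Tor D)) p (E : (nat * lattice -> C) -> C) k :
  closure A p -> continuous (fun x : cone_points D => E (set_val x)) ->
  (forall c x, E (scale_cone c x) = c ^+ k * E x) ->
  E (Tor_coord p) != 0 -> exists2 q, A q & E (Tor_coord q) != 0.
Proof.
move=> Ap cE hE Ep.
have tor (x : cone_points D) : (E (Tor_coord (to_Tor x)) != 0) = (E (set_val x) != 0).
  have [c c0 H] := Tor_coordE x.
  have -> : Tor_coord (to_Tor x) = scale_cone c (set_val x) by apply/funext.
  by rewrite hE mulf_eq0 expf_eq0 (negbTE c0) andbF.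
pose U : set (Tor D) := [set q | E (Tor_coord q) != 0].
have oU : open U.
  rewrite /open /= /quotient_open.
  have -> : \pi_(Tor D) @^-1` U = (fun x : cone_points D => E (set_val x)) @^-1` [set z | z != 0].
    apply/seteqP; split=> x H; first by rewrite /= -tor; exact: H.
    by have : E (set_val x) != 0 by []; rewrite -tor; exact.
  rewrite openE => x Ex; have H := @cvgr_neq0 _ _ _ _ (nbhs_filter x) _ _ (cE x) Ex; exact: H.
have [q [Aq Uq]] := Ap U (open_nbhs_nbhs (conj oU Ep)).
by exists q.
Qed.

End TorClosure.

Lemma monomial_derivative (K : comPzRingType) k (z : 'I_k -> K) (m : multinom k) i :
  m i != 0%N -> \prod_j z j ^+ m j = z i * \prod_j z j ^+ mnm_sub m (mnm1 i) j.
Proof.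
move=> mi; rewrite (bigD1 i) //= [in RHS](bigD1 i) //= mulrA.
rewrite mnmBE mnm1E eqxx subn1 -exprS prednK ?lt0n //.
congr (_ * _); apply: eq_bigr => j ji.
by rewrite mnmBE mnm1E eq_sym (negbTE ji) subn0.
Qed.

Lemma meval1_mderiv_sum (K : comNzRingType) k (r : seq (multinom k)) c (v : 'I_k -> K) i :
  (forall j, v j = 1) ->
  meval v (mderiv i (\sum_(m <- r) c m *: mpolyX K m)) = \sum_(m <- r) c m * (m i)%:R.
Proof.
move=> v1; rewrite (raddf_sum (mderiv i)) (raddf_sum (meval v)); apply: eq_bigr => m _ /=.
rewrite mderivZ mderivX !mevalZ mevalX big1 ?mulr1 // => j _.
by rewrite v1 expr1n.
Qed.

Section Gauss.
Variables (R : realType) (n : nat) (P : mpoly n (cplx R)).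
Local Notation C := (cplx R).
Local Notation D := (newton_polytope P).
Local Notation S := (cone_semigroup D).
Local Notation lattice := 'rV[int]_n.

Lemma proj_coord_neq0 m (L : @proj_space R m) : proj_coord L != 0.
Proof.
rewrite /proj_coord vpick0; apply: contraTneq (valP L) => /= ->.
by rewrite dimv0.
Qed.

Lemma proj_coord_line m (L : @proj_space R m) v : val L = <[v]>%VS ->
  exists2 k : C, k != 0 & proj_coord L = k *: v.
Proof.
move=> E; have : proj_coord L \in <[v]>%VS by rewrite -E memv_pick.
case/vlineP => k kE; exists k => //.
by have := proj_coord_neq0 L; rewrite kE scaler_eq0 negb_or => /andP[].
Qed.

Lemma equation_scale c (x : nat * lattice -> C) :
  equation_section P (scale_cone c x) = c * equation_section P x.
Proof. by rewrite mulr_sumr; apply: eq_bigr => m _; rewrite mulrCA. Qed.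

Lemma gradient_scale c (x : nat * lattice -> C) :
  gradient_section P (scale_cone c x) = c *: gradient_section P x.
Proof.
apply/rowP => i; rewrite !mxE mulr_sumr; apply: eq_bigr => m _.
by rewrite mulrCA.
Qed.

Lemma equation_continuous : continuous (fun x : cone_points D => equation_section P (set_val x)).
Proof.
move=> x; rewrite /equation_section /continuous_at.
apply: (cvg_sumr (FF := nbhs_filter x)
  (f := fun m (x : cone_points D) => mcoeff m P * set_val x (exponent_point m))) => u.
exact: (@cvgM _ _ _ (nbhs_filter x) _ _ _ _ (cvg_cst _)
  (@cone_point_coord_continuous _ _ _ _ x)).
Qed.

Lemma gradient_continuous i :
  continuous (fun x : cone_points D => gradient_section P (set_val x) 0 i : C).
Proof.
have -> : (fun x : cone_points D => gradient_section P (set_val x) 0 i : C) =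
    (fun x => \sum_(m <- msupp P) mcoeff m P * (m i)%:R * set_val x (exponent_point m)).
  by apply/funext => x; rewrite mxE.
move=> x; rewrite /continuous_at.
apply: (cvg_sumr (FF := nbhs_filter x)
  (f := fun m (x : cone_points D) =>
    mcoeff m P * (m i)%:R * set_val x (exponent_point m))) => u.
exact: (@cvgM _ _ _ (nbhs_filter x) _ _ _ _ (cvg_cst _)
  (@cone_point_coord_continuous _ _ _ _ x)).
Qed.

Lemma gradient_torus (z : 'rV[C]_n) : torus z ->
  gradient_section P (fun s => monomial z s.2) = log_gradient P z.
Proof.
move=> zT; apply/rowP => i; rewrite !mxE /mderiv raddf_sum mulr_sumr.
apply: eq_bigr => m _ /=; rewrite mevalZ mevalX monomial_exponent.
rewrite [RHS]mulrCA [in RHS](mulrC _ (mcoeff m P)).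
have [->|mi] := eqVneq (m i) 0%N; first by rewrite !mulr0 !mul0r.
by rewrite (monomial_derivative (z 0) mi).
Qed.

Lemma equation_torus (z : 'rV[C]_n) :
  equation_section P (fun s => monomial z s.2) = meval (z 0) P.
Proof.
rewrite -[RHS]mul1r -equation_section_torus; apply: eq_bigr => m _.
by rewrite expr1n mul1r.
Qed.

Lemma Tor_coord_torus z (q : Tor D) : Tor_of_torus z q -> exists2 c : C, c != 0 &
  forall s, S s -> Tor_coord q s = scale_cone c (fun s => monomial z s.2) s.
Proof.
move=> [x -> xE]; have [c c0 H] := Tor_coordE x; exists c => // s Ss.
by rewrite H xE.
Qed.

Lemma eq_equation (x y : nat * lattice -> C) : (forall s, S s -> x s = y s) ->
  equation_section P x = equation_section P y.
Proof.
move=> xy; apply: eq_big_seq => m mP; rewrite xy //.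
exact: exponent_point_in_cone.
Qed.

Lemma eq_gradient (x y : nat * lattice -> C) : (forall s, S s -> x s = y s) ->
  gradient_section P x = gradient_section P y.
Proof.
move=> xy; apply/rowP => i; rewrite !mxE; apply: eq_big_seq => m mP; rewrite xy //.
exact: exponent_point_in_cone.
Qed.

Lemma equation_of_closure p : closure_in_Tor P p -> equation_section P (Tor_coord p) = 0.
Proof.
move=> cp; apply/eqP/negPn/negP => Fp.
have [|q [z [zT zP] zq]] :=
    @closure_nonvanishing _ _ _ _ p (equation_section P) 1 cp (@equation_continuous) _ Fp.
  by move=> c x; rewrite equation_scale expr1.
move/negP; apply; apply/eqP.
have [c c0 E] := Tor_coord_torus zq.
by rewrite (eq_equation E) equation_scale equation_torus zP mulr0.
Qed.

Lemma gradient_orbit_equation (x : cone_points D) i :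
  meval ((const_mx 1 : 'rV[C]_n) 0) (mderiv i (orbit_equation x)) =
  gradient_section P (set_val x) 0 i.
Proof.
rewrite mxE /orbit_equation meval1_mderiv_sum => [|j]; last by rewrite mxE.
by apply: eq_bigr => m _; rewrite mulrAC.
Qed.

Lemma monomial_const1 (m : lattice) : monomial (const_mx 1 : 'rV[C]_n) m = 1.
Proof. by apply: big1 => i _; rewrite mxE exp1rz. Qed.

(** The derivatives of the orbit equation of x at the point 1 of the torus are
    the G_i (x). *)
Lemma gradient_neq0 (x : cone_points D) : torically_nonsingular P ->
  closure_in_Tor P (to_Tor x) -> gradient_section P (set_val x) != 0.
Proof.
move=> [_ Pns] cx.
have oneT : torus (const_mx 1 : 'rV[C]_n) by move=> i; rewrite mxE oner_neq0.
pose one : torus := SigSub (mem_set oneT).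
have oneE : to_Tor (cone_act one x) = to_Tor x.
  apply/to_Tor_eq; exists 1; rewrite ?oner_neq0 // => s.
  rewrite expr1n mul1r.
  have -> : set_val (cone_act one x) s = monomial (const_mx 1 : 'rV[C]_n) s.2 * set_val x s by [].
  by rewrite monomial_const1 mul1r.
have [|i] := Pns x one; first by rewrite oneE.
rewrite gradient_orbit_equation; apply: contraNneq => ->.
by rewrite mxE.
Qed.

Lemma no_common_zero (x : cone_points D) : torically_nonsingular P ->
  equation_section P (set_val x) = 0 -> gradient_section P (set_val x) != 0.
Proof. by move=> Pns /closure_of_equation; exact: gradient_neq0. Qed.

End Gauss.

(** * The logarithmic Gauss map on the closure *)

Lemma separating_form (K : idomainType) k (v w : 'rV[K]_k) : v != 0 -> w != 0 ->
  exists b : 'rV[K]_k, dotv b v != 0 /\ dotv b w != 0.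
Proof.
move=> /rV0Pn[i vi] /rV0Pn[j wj].
have dE a u : dotv (delta_mx 0 a) u = u 0 a :> K by rewrite dotvC dotv_delta.
have [vj|vj] := eqVneq (v 0 j) 0; last by exists (delta_mx 0 j); rewrite !dE.
have [wi|wi] := eqVneq (w 0 i) 0; last by exists (delta_mx 0 i); rewrite !dE.
by exists (delta_mx 0 i + delta_mx 0 j); rewrite !dotvDl !dE vj wi addr0 add0r.
Qed.

Lemma meval_linear_form (K : comNzRingType) k (b v : 'rV[K]_k) :
  meval (v 0) (\sum_i b 0 i *: mpolyX K (mnm1 i)) = dotv b v.
Proof.
by rewrite (raddf_sum (meval _)); apply: eq_bigr => i _; rewrite /= mevalZ mevalXU.
Qed.

Lemma linear_form_homog (K : comNzRingType) k (b : 'rV[K]_k) :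
  (\sum_i b 0 i *: mpolyX K (mnm1 i)) \is ishomog1 1 mdeg.
Proof.
by apply: rpred_sum => i _; apply: rpredZ; rewrite dhomogX; apply/eqP; exact: mdeg1.
Qed.

Lemma cross_multiply (K : fieldType) (a b c d : K) :
  b != 0 -> d != 0 -> a / b = c / d -> a * d = c * b.
Proof. by move=> b0 d0 /eqP; rewrite eqr_div // => /eqP. Qed.

Section GaussMap.
Variables (R : realType) (n : nat) (P : mpoly n (cplx R)).
Local Notation C := (cplx R).
Local Notation D := (newton_polytope P).
Local Notation S := (cone_semigroup D).
Local Notation lattice := 'rV[int]_n.
Variable gamma : closure_in_Tor P -> @proj_space R n.
Hypothesis gammaP : extended_log_gauss_map gamma.
Hypothesis Pns : torically_nonsingular P.

Lemma linear_form_scale (b : 'rV[C]_n) c (x : nat * lattice -> C) :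
  dotv b (gradient_section P (scale_cone c x)) = c * dotv b (gradient_section P x).
Proof. by rewrite gradient_scale dotvZr. Qed.

Lemma linear_form_continuous (b : 'rV[C]_n) :
  continuous (fun x : cone_points D => dotv b (gradient_section P (set_val x)) : C).
Proof.
move=> x; rewrite /dotv /continuous_at.
apply: (cvg_sumr (FF := nbhs_filter x)
  (f := fun i (x : cone_points D) => b 0 i * gradient_section P (set_val x) 0 i)) => i.
exact: (@cvgM _ _ _ (nbhs_filter x) _ _ _ _ (cvg_cst _) (@gradient_continuous _ _ P i x)).
Qed.

(** Let b be a linear form that vanishes neither at gamma p nor at G (p).  The
    ratio of the i-th coordinate to b is regular at gamma p, so its pull-back by
    gamma is a quotient of forms near p.  On the hypersurface this quotient is
    the ratio of G_i to b (G), whenever the denominators are not zero; as a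
    polynomial identity, after multiplication by the denominators, this passes to
    the limit p. *)
Lemma log_gauss_map_closure (p : closure_in_Tor P) :
  exists k : C, gradient_section P (Tor_coord (set_val p)) = k *: proj_coord (gamma p).
Proof.
set w := proj_coord (gamma p); set w' := gradient_section _ _.
have w0 : w != 0 by exact: proj_coord_neq0.
have w'0 : w' != 0.
  have cp : closure_in_Tor P (to_Tor (repr (set_val p))).
    by rewrite repr_Tor; exact: set_mem (valP p).
  exact: gradient_neq0 Pns cp.
have [b [bw bw']] := separating_form w0 w'0.
exists (dotv b w' / dotv b w); apply/rowP => i; rewrite [RHS]mxE.
have [galg ggrad] := gammaP.
pose B := \sum_i b 0 i *: mpolyX C (mnm1 i).
pose g (L : @proj_space R n) : C := proj_coord L 0 i / dotv b (proj_coord L).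
have gg : @proj_germs R n (gamma p) g.
  exists 1%N, (mpolyX C (mnm1 i)), B; split.
  - by rewrite dhomogX; apply/eqP; exact: mdeg1.
  - exact: linear_form_homog.
  - by rewrite meval_linear_form.
  - by move=> L' _; rewrite meval_linear_form mevalXU.
have [h [d [a1 [a2 [a2p hE]]]] hg] := galg p g gg.
(* The first factors make E vanish wherever the germ h or the form b does not
   control the ratio. *)
pose E x : C := form_eval d a2 x * (dotv b (gradient_section P x) *
   (gradient_section P x 0 i * form_eval d a2 x -
    form_eval d a1 x * dotv b (gradient_section P x))).
have E0 : E (Tor_coord (set_val p)) = 0.
  apply/eqP/negPn/negP => Ep.
  have cp := set_mem (valP p).
  have [||q [z zP zq]] := @closure_nonvanishing _ _ _ _ _ E (d + (1 + (1 + d))) cp _ _ Ep.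
  - move=> x; rewrite /E /continuous_at.
    have ca := @form_eval_continuous _ _ D d a1 x.
    have cb := @form_eval_continuous _ _ D d a2 x.
    have cl := @linear_form_continuous b x.
    have cg := @gradient_continuous _ _ P i x.
    have FF := nbhs_filter x.
    exact: (cvgM cb (cvgM cl (cvgB (cvgM cg cb) (cvgM ca cl)))).
  - move=> c x; rewrite /E !form_eval_scale !linear_form_scale gradient_scale mxE.
    by rewrite !exprD expr1; ring.
  move/negP; apply; apply/eqP; rewrite /E.
  have [c c0 qE] := Tor_coord_torus zq.
  have GE : gradient_section P (Tor_coord q) = c *: log_gradient P z.
    by rewrite (eq_gradient qE) gradient_scale gradient_torus //; case: zP.
  have cq : closure_in_Tor P q by apply: subset_closure; exists z.
  pose q' : closure_in_Tor P := SigSub (mem_set cq).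
  have [k k0 lE] := proj_coord_line (ggrad z q' zP zq).
  have [->|a2q] := eqVneq (form_eval d a2 (Tor_coord q)) 0; first by rewrite mul0r.
  have [->|bq] := eqVneq (dotv b (gradient_section P (Tor_coord q))) 0.
    by rewrite mul0r mulr0.
  have := hg q'; rewrite /= /g lE mxE dotvZr (hE q) //.
  have -> : k * log_gradient P z 0 i / (k * dotv b (log_gradient P z)) =
      gradient_section P (Tor_coord q) 0 i / dotv b (gradient_section P (Tor_coord q)).
    have cE : (c *: log_gradient P z) 0 i = c * log_gradient P z 0 i by rewrite [LHS]mxE.
    by rewrite GE dotvZr cE -!mulf_div !divff // !mul1r.
  move=> /(cross_multiply bq a2q) ->.
  by rewrite subrr !mulr0.
move/eqP: E0; rewrite /E -/w' !mulf_eq0 (negbTE a2p) (negbTE bw') /= subr_eq0 => /eqP Ew.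
have := hg p; rewrite /= /g -/w (hE _ a2p) => gw.
move/(cross_multiply bw a2p) : gw => gw.
by apply: (mulIf a2p); rewrite Ew -[RHS]mulrA gw [X in _ = _ * X]mulrC [RHS]mulrA divfK // mulrC.
Qed.

End GaussMap.

(** * The equations of a fibre *)

Lemma meval_weighted (A : comNzRingType) N (v : 'I_N -> A) (c : A) (w : 'I_N -> nat) p :
  meval (fun i => c ^+ w i * v i) (mpolyX A p) =
  c ^+ (\sum_i w i * p i)%N * meval v (mpolyX A p).
Proof.
rewrite !mevalX -prodrXr -big_split; apply: eq_bigr => i _ /=.
by rewrite exprMn exprM.
Qed.

Section FiberEquations.
Variables (R : realType) (n : nat) (P : mpoly n (cplx R)).
Local Notation C := (cplx R).
Local Notation D := (newton_polytope P).
Local Notation S := (cone_semigroup D).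
Local Notation lattice := 'rV[int]_n.
Variables (K : nat) (b : 'I_K -> nat * lattice).
Hypothesis bS : forall i, S (b i).
Hypothesis b_gt0 : forall i, (0 < (b i).1)%N.
Hypothesis P0 : msupp P != [::].
Variable al : nat * lattice -> multinom K.
Hypothesis alP : forall s, S s -> s = \sum_i b i *+ al s i.

Definition combination (p : multinom K) : nat * lattice := \sum_i b i *+ p i.

Lemma combination_al s : S s -> combination (al s) = s.
Proof. by move=> /alP. Qed.

Lemma combination0 : combination mnm0 = 0.
Proof. by rewrite /combination big1 // => i _; rewrite mnm0E. Qed.

Lemma combinationD p q : combination (mnm_add p q) = combination p + combination q.
Proof.
by rewrite -big_split; apply: eq_bigr => i _ /=; rewrite mnmDE mulrnDr.
Qed.

Lemma combination1 i : combination (mnm1 i) = b i.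
Proof.
rewrite /combination (bigD1 i) //= mnm1E eqxx big1 ?addr0 // => j ji.
by rewrite mnm1E eq_sym (negbTE ji).
Qed.

Definition equation_poly : mpoly K C :=
  \sum_(m <- msupp P) mcoeff m P *: mpolyX C (al (exponent_point m)).

Definition gradient_poly (j : 'I_n) : mpoly K C :=
  \sum_(m <- msupp P) (mcoeff m P * (m j)%:R) *: mpolyX C (al (exponent_point m)).

(** All binomial relations between the generators b i, enumerated through an
    enumeration of the pairs of exponent vectors. *)
Definition relation_poly (k : nat) : mpoly K C :=
  if unpickle k is Some (p, q) then
    if combination p == combination q then mpolyX C p - mpolyX C q else 0
  else 0.

Lemma meval_equation_poly (v : 'I_K -> C) (x : nat * lattice -> C) :
  (forall s, S s -> meval v (mpolyX C (al s)) = x s) ->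
  meval v equation_poly = equation_section P x.
Proof.
move=> vx; rewrite (raddf_sum (meval v)); apply: eq_big_seq => m mP /=.
by rewrite mevalZ vx //; exact: exponent_point_in_cone.
Qed.

Lemma meval_gradient_poly (v : 'I_K -> C) (x : nat * lattice -> C) j :
  (forall s, S s -> meval v (mpolyX C (al s)) = x s) ->
  meval v (gradient_poly j) = gradient_section P x 0 j.
Proof.
move=> vx; rewrite (raddf_sum (meval v)) mxE; apply: eq_big_seq => m mP /=.
by rewrite mevalZ vx //; exact: exponent_point_in_cone.
Qed.

Lemma cone_point_relation (x : cone_points D) k :
  meval (fun i => set_val x (b i)) (relation_poly k) = 0.
Proof.
rewrite /relation_poly; case: unpickle => [[p q]|]; last by rewrite meval0.
case: eqP => [pq|_]; last by rewrite meval0.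
have E r : meval (fun i => set_val x (b i)) (mpolyX C r) = set_val x (combination r).
  rewrite mevalX cone_point_sum //; last by move=> i; exact: cone_semigroupMn.
  by apply: eq_bigr => i _; rewrite cone_pointMn.
by rewrite mevalB !E pq subrr.
Qed.

Lemma cone_point_meval (x : cone_points D) s : S s ->
  meval (fun i => set_val x (b i)) (mpolyX C (al s)) = set_val x s.
Proof.
move=> Ss; rewrite mevalX {2}(alP Ss) cone_point_sum //.
  by apply: eq_bigr => i _; rewrite cone_pointMn.
by move=> i; exact: cone_semigroupMn.
Qed.

(** A solution of all the binomial relations is multiplicative on combinations
    of the generators, hence defines a semigroup homomorphism. *)
Lemma solve_relations (v : 'I_K -> C) (i0 : 'I_K) :
  (forall k, meval v (relation_poly k) = 0) -> v i0 != 0 ->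
  exists x : cone_points D, forall i, set_val x (b i) = v i.
Proof.
move=> vrel vi0.
have rel p q : combination p = combination q -> meval v (mpolyX C p) = meval v (mpolyX C q).
  move=> pq; have := vrel (pickle (p, q)); rewrite /relation_poly pickleK pq eqxx mevalB.
  by move/eqP; rewrite subr_eq0 => /eqP.
pose f : {ptws (nat * lattice) -> C} :=
  fun s => if `[< S s >] then meval v (mpolyX C (al s)) else 0.
have fE s p : S s -> combination p = s -> f s = meval v (mpolyX C p).
  by move=> Ss ps; rewrite /f asboolT //; apply: rel; rewrite combination_al.
have fb i : f (b i) = v i.
  by rewrite (fE _ (mnm1 i)) ?combination1 // mevalXU.
have fP : f \in cone_points D.
  apply/mem_set; split.
  - rewrite (fE _ mnm0) ?combination0 //; last exact: cone_semigroup0.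
    by rewrite mpolyX0 meval1.
  - move=> s t Ss St; rewrite (fE _ (mnm_add (al s) (al t))).
    + by rewrite mpolyXD mevalM /f !asboolT.
    + exact: cone_semigroupD.
    + by rewrite combinationD !combination_al.
  - by move=> s nSs; rewrite /f asboolF.
  - by exists (b i0) => //; rewrite fb; split.
by exists (SigSub fP) => i; rewrite -fb.
Qed.

Lemma meval_scale (v : 'I_K -> C) (c : C) p :
  meval (fun i => c ^+ (b i).1 * v i) (mpolyX C p) =
  c ^+ (combination p).1 * meval v (mpolyX C p).
Proof.
rewrite meval_weighted pair_sum1; congr (_ ^+ _ * _).
by apply: eq_bigr => i _; rewrite pair_mulrn.
Qed.

End FiberEquations.

(** * Boundedness of a fibre *)

Section WeightedSphere.
Variables (C : numClosedFieldType) (K : nat) (d : 'I_K -> nat).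
Hypothesis d_gt0 : forall i, (0 < d i)%N.

(** A common multiple of the weights. *)
Definition total_weight := (\prod_i d i)%N.

(** Homogeneous of degree [total_weight] for the action of the scalars with
    weights d; its unit sphere is compact and meets every orbit but 0. *)
Definition weighted_norm (v : 'I_K -> C) : C := \sum_i `|v i| ^+ (total_weight %/ d i).

Lemma total_weight_gt0 : (0 < total_weight)%N.
Proof. by rewrite prodn_gt0. Qed.

Lemma dvdn_total_weight i : (d i %| total_weight)%N.
Proof. by rewrite /total_weight (bigD1 i) //= dvdn_mulr. Qed.

Lemma codegree_gt0 i : (0 < total_weight %/ d i)%N.
Proof. by rewrite divn_gt0 // dvdn_leq ?total_weight_gt0 // dvdn_total_weight. Qed.

Lemma weighted_norm_le1 v i : weighted_norm v = 1 -> `|v i| <= 1.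
Proof.
move=> v1; rewrite -(expr_le1 (codegree_gt0 i)) // -v1 /weighted_norm (bigD1 i) //=.
by rewrite lerDl sumr_ge0 // => j _; rewrite exprn_ge0.
Qed.

Lemma weighted_normalization v i (M : C) : 1 <= M -> ~ `|v i| <= M ->
  exists c : C, [/\ c != 0, weighted_norm (fun j => c ^+ d j * v j) = 1
    & `|c| ^+ total_weight <= M^-1].
Proof.
move=> M1 vM; have M0 : 0 < M by apply: lt_le_trans M1.
have {}vM : M < `|v i|.
  by rewrite real_ltNge ?normr_real ?gtr0_real //; exact/negP.
have TM : M <= weighted_norm v.
  rewrite /weighted_norm (bigD1 i) //= (le_trans (ltW vM)) //.
  rewrite (@le_trans _ _ (`|v i| ^+ (total_weight %/ d i))) //.
    by rewrite ler_eXnr ?codegree_gt0 // (le_trans M1) // ltW.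
  by rewrite lerDl sumr_ge0 // => j _; rewrite exprn_ge0.
have T0 : 0 < weighted_norm v by apply: lt_le_trans TM.
have Ti0 : 0 < (weighted_norm v)^-1 by rewrite invr_gt0.
have cN : (total_weight.-root (weighted_norm v)^-1) ^+ total_weight = (weighted_norm v)^-1.
  by rewrite rootCK // total_weight_gt0.
exists (total_weight.-root (weighted_norm v)^-1); split.
- by rewrite rootC_eq0 ?total_weight_gt0 // invr_eq0 gt_eqF.
- set c := total_weight.-root _ in cN *.
  have E j : `|c ^+ d j * v j| ^+ (total_weight %/ d j) =
      (weighted_norm v)^-1 * `|v j| ^+ (total_weight %/ d j).
    rewrite normrM exprMn normrX -exprM mulnC divnK ?dvdn_total_weight //.
    by rewrite -[`|c| ^+ _]normrX cN (gtr0_norm Ti0).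
  rewrite {1}/weighted_norm (eq_bigr _ (fun j _ => E j)).
  by rewrite -mulr_sumr mulVf // gt_eqF.
- by rewrite -normrX cN (gtr0_norm Ti0) lef_pV2.
Qed.

End WeightedSphere.

Lemma cvg_weighted_norm (F : numClosedFieldType) (K : nat) (d : 'I_K -> nat)
    (T : Type) (G : set_system T) (FG : ProperFilter G)
    (u : T -> 'I_K -> F) (a : 'I_K -> F) :
  (forall i, (fun t => u t i) @ G --> a i) ->
  (fun t => weighted_norm d (u t)) @ G --> weighted_norm d a.
Proof.
move=> ua; apply: (cvg_sumr (f := fun i t => `|u t i| ^+ _)) => i.
by apply: cvg_exprn; exact: cvg_norm.
Qed.

Section Bounded.
Variables (R : realType) (n : nat) (P : mpoly n (cplx R)).
Local Notation C := (cplx R).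
Local Notation D := (newton_polytope P).
Local Notation S := (cone_semigroup D).
Local Notation lattice := 'rV[int]_n.
Variables (K : nat) (b : 'I_K -> nat * lattice).
Hypothesis bS : forall i, S (b i).
Hypothesis b_gt0 : forall i, (0 < (b i).1)%N.
Hypothesis P0 : msupp P != [::].
Variable al : nat * lattice -> multinom K.
Hypothesis alP : forall s, S s -> s = \sum_i b i *+ al s i.
Hypothesis Pns : torically_nonsingular P.
Variable y0 : 'rV[C]_n.

(** The equations F = 0 and G = y0, and finitely many of the relations that
    characterize cone points, in the coordinates at the generators. *)
Definition fiber_system (k : nat) : seq (mpoly K C) :=
  equation_poly P al :: [seq gradient_poly P al j - mpolyC K (y0 0 j) | j <- enum 'I_n] ++
  [seq relation_poly R b j | j <- iota 0 k].

Lemma fiber_systemP k (v : 'I_K -> C) :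
  (forall p, p \in fiber_system k -> meval v p = 0) ->
  [/\ meval v (equation_poly P al) = 0,
      forall j, meval v (gradient_poly P al j) = y0 0 j
    & forall j, (j < k)%N -> meval v (relation_poly R b j) = 0].
Proof.
move=> H; split; first by apply: H; rewrite mem_head.
  move=> j; have := H (gradient_poly P al j - mpolyC K (y0 0 j)).
  rewrite mevalB mevalC => /(_ _)/eqP; rewrite subr_eq0 => H'; apply/eqP/H'.
  by rewrite inE mem_cat (map_f (fun j => gradient_poly P al j - mpolyC K (y0 0 j))) ?orbT // mem_enum.
move=> j jk; apply: H; rewrite inE mem_cat (map_f (relation_poly R b)) ?orbT //.
by rewrite mem_iota.
Qed.

Local Notation act c v := (fun i => c ^+ (b i).1 * v i).

Lemma meval_scale_exponent v c m : m \in msupp P ->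
  meval (act c v) (mpolyX C (al (exponent_point m))) =
  c * meval v (mpolyX C (al (exponent_point m))).
Proof.
move=> mP; rewrite (meval_scale b) (combination_al alP) ?expr1 //.
exact: exponent_point_in_cone.
Qed.

Lemma equation_poly_scale v (c : C) :
  meval (act c v) (equation_poly P al) = c * meval v (equation_poly P al).
Proof.
rewrite !(raddf_sum (meval _)) mulr_sumr; apply: eq_big_seq => m mP /=.
by rewrite !mevalZ meval_scale_exponent // mulrCA.
Qed.

Lemma gradient_poly_scale v (c : C) j :
  meval (act c v) (gradient_poly P al j) = c * meval v (gradient_poly P al j).
Proof.
rewrite !(raddf_sum (meval _)) mulr_sumr; apply: eq_big_seq => m mP /=.
by rewrite !mevalZ meval_scale_exponent // mulrCA.
Qed.

Lemma relation_poly_scale v (c : C) j :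
  meval v (relation_poly R b j) = 0 -> meval (act c v) (relation_poly R b j) = 0.
Proof.
rewrite /relation_poly; case: unpickle => [[p q]|]; last by rewrite !meval0.
case: eqP => [pq|_]; last by rewrite !meval0.
rewrite !mevalB !(meval_scale b) pq -mulrBr => ->.
by rewrite mulr0.
Qed.

(** Suppose that the first k relations never suffice.  For each k take a
    solution with a coordinate larger than k + 1 and rescale it to the unit
    sphere of the weighted norm.  The scaling factors tend to 0, so along an
    ultrafilter the rescaled solutions tend to a point of the sphere at which F,
    all G_i and all binomial relations vanish.  It is a cone point, which
    contradicts [no_common_zero]. *)
Lemma fiber_system_bounded : exists (k : nat) (M : C),
  forall v, (forall p, p \in fiber_system k -> meval v p = 0) -> forall i, `|v i| <= M.
Proof.
apply: contrapT => unb.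
pose d i := (b i).1.
have seqs k : exists ec : ('I_K -> C) * C, [/\ weighted_norm d ec.1 = 1,
    `|ec.2| ^+ total_weight d <= k.+1%:R^-1, meval ec.1 (equation_poly P al) = 0,
    forall j, meval ec.1 (gradient_poly P al j) = ec.2 * y0 0 j &
    forall j, (j < k)%N -> meval ec.1 (relation_poly R b j) = 0].
  have [v [vsys [i vi]]] : exists v, (forall p, p \in fiber_system k -> meval v p = 0) /\
      exists i, ~ `|v i| <= k.+1%:R.
    apply: contrapT => H; apply: unb; exists k, k.+1%:R => v vsys i.
    by apply: contrapT => vi; apply: H; exists v; split=> //; exists i.
  have k1 : 1 <= k.+1%:R :> C by rewrite ler1n.
  have [c [c0 cn cM]] := weighted_normalization b_gt0 k1 vi.
  have [veq vgr vrel] := fiber_systemP vsys.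
  exists (act c v, c); split=> //=.
  - by rewrite equation_poly_scale veq mulr0.
  - by move=> j; rewrite gradient_poly_scale vgr.
  - by move=> j /vrel; exact: relation_poly_scale.
have /boolp.choice[ec ecP] := seqs.
have [U [UU Uoo]] := ultraFilterLemma eventually_filter.
have UP : ProperFilter U := @ultra_proper _ _ UU.
have lim i : exists a : C, (fun k => (ec k).1 i) @ U --> a.
  apply: (ultra_bounded_cvg (M := 1)) => k.
  by have [w1 _ _ _ _] := ecP k; exact: (weighted_norm_le1 b_gt0).
have /boolp.choice[z zP] := lim.
have zlim p := @cvg_meval C K nat U UP (fun k => (ec k).1) z p zP.
have c_lim : (fun k => (ec k).2) @ U --> (0 : C).
  apply: cvg_trans (_ : (fun k => (ec k).2) @ \oo --> (0 : C)).
    by move=> A; exact: Uoo.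
  apply/cvgrPdist_lt => e e0.
  have N0 := total_weight_gt0 b_gt0.
  have eN0 : 0 < e ^+ total_weight d by rewrite exprn_gt0.
  apply: filterS (near_natSinv_lt eN0) => k ke; rewrite sub0r normrN.
  have [_ cM _ _ _] := ecP k.
  by rewrite -(ltr_pXn2r N0) ?nnegrE ?normr_ge0 ?(ltW e0) // (le_lt_trans cM).
have zeq : meval z (equation_poly P al) = 0.
  apply: (@cvg_eq_limit C nat U UP _ _ _ _ (zlim _) (@cvg_cst C 0 _ _ _)).
  by apply: filterE => k; have [_ _ ->] := ecP k.
have zgr j : meval z (gradient_poly P al j) = 0.
  rewrite -(mul0r (y0 0 j)).
  apply: (@cvg_eq_limit C nat U UP _ _ _ _ (zlim _) (cvgM c_lim (@cvg_cst C (y0 0 j) _ _ _))).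
  by apply: filterE => k; have [_ _ _ ->] := ecP k.
have zrel j : meval z (relation_poly R b j) = 0.
  apply: (@cvg_eq_limit C nat U UP _ _ _ _ (zlim _) (@cvg_cst C 0 _ _ _)).
  apply: Uoo; exists j.+1 => // k /= jk.
  by have [_ _ _ _ ->] := ecP k.
have z1 : weighted_norm d z = 1.
  have nlim := @cvg_weighted_norm C K d nat U UP (fun k => (ec k).1) z zP.
  apply: (@cvg_eq_limit C nat U UP _ _ _ _ nlim (@cvg_cst C 1 _ _ _)).
  by apply: filterE => k; have [->] := ecP k.
have [i zi] : exists i, z i != 0.
  apply: contrapT => z0; move: z1; rewrite /weighted_norm.
  rewrite big1 => [/esym/eqP|i _]; first by rewrite oner_eq0.
  have -> : z i = 0 by apply/eqP/negPn/negP => zi; apply: z0; exists i.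
  by rewrite normr0 expr0n gtn_eqF // codegree_gt0.
have [x xb] := solve_relations bS b_gt0 P0 alP zrel zi.
have zE : z = fun i => set_val x (b i) by apply/funext => j; rewrite xb.
have xz s : S s -> meval z (mpolyX C (al s)) = set_val x s.
  by move=> Ss; rewrite zE; exact: cone_point_meval.
have := @no_common_zero _ _ _ x Pns; rewrite -(meval_equation_poly xz) zeq => /(_ erefl).
move/negP; apply; apply/eqP/rowP => j.
by rewrite -(meval_gradient_poly j xz) zgr mxE.
Qed.

End Bounded.

(** * Finiteness of the fibres *)

Lemma finite_set_injF (T : Type) (F : finType) (A : set T) (f : T -> F) :
  (forall p q, A p -> A q -> f p = f q -> p = q) -> finite_set A.
Proof.
move=> finj; have [[p0 _]|noA] := pselect (exists p, A p); last first.
  suff -> : A = set0 by exact: finite_set0.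
  by apply/seteqP; split=> // p Ap; apply: noA; exists p.
have [g gP] : {g : F -> T | forall p, A p -> g (f p) = p}.
  exists (fun v =>
    if pselect (exists p, A p /\ f p = v) is left H then projT1 (cid H) else p0).
  move=> p Ap; case: pselect => [H|[]]; last by exists p.
  by case: cid => q /= [Aq fq]; apply: finj.
apply: (@sub_finite_set _ _ (g @` setT)); last exact/finite_image/finite_finset.
by move=> p Ap; exists (f p) => //; exact: gP.
Qed.

Section Fiber.
Variables (R : realType) (n : nat) (P : mpoly n (cplx R)).
Local Notation C := (cplx R).
Local Notation D := (newton_polytope P).
Local Notation S := (cone_semigroup D).
Local Notation lattice := 'rV[int]_n.

Lemma scale_cone_point (x : cone_points D) (c : C) : c != 0 ->
  exists x' : cone_points D, (forall s, set_val x' s = scale_cone c (set_val x) s) /\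
    to_Tor x' = to_Tor x.
Proof.
move=> c0; pose f : {ptws (nat * lattice) -> C} := scale_cone c (set_val x).
have fP : f \in cone_points D.
  apply/mem_set; rewrite /f /scale_cone; split.
  - by rewrite cone_point1 expr0 mulr1.
  - by move=> s t Ss St; rewrite cone_pointD // exprD mulrACA.
  - by move=> s nSs; rewrite cone_point_out // mulr0.
  - have [s Ss [s0 xs]] := cone_point_neq0 x.
    by exists s => //; split=> //; rewrite mulf_neq0 ?expf_neq0.
exists (SigSub fP); split=> //.
by apply/esym/to_Tor_eq; exists c.
Qed.

Lemma cone_point_gen_inj (K : nat) (b : 'I_K -> nat * lattice) (x x' : cone_points D) :
  (forall i, S (b i)) ->
  (forall s, S s -> exists a : 'I_K -> nat, s = \sum_i b i *+ a i) ->
  (forall i, set_val x (b i) = set_val x' (b i)) -> to_Tor x = to_Tor x'.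
Proof.
move=> bS bP xx'; apply/to_Tor_eq; exists 1; rewrite ?oner_neq0 // => s.
rewrite expr1n mul1r; have [Ss|nSs] := pselect (S s); last by rewrite !cone_point_out.
have [a ->] := bP s Ss; have Sb i : S (b i *+ a i) by exact: cone_semigroupMn.
by rewrite !cone_point_sum //; apply: eq_bigr => i _; rewrite !cone_pointMn // xx'.
Qed.

End Fiber.

Theorem theorem1p2 (R : realType) (n : nat) (P : mpoly.mpoly n (cplx R))
    (P_nonsingular : torically_nonsingular P)
    (P_projective : torically_projective P)
    (gamma : closure_in_Tor P -> @proj_space R n)
    (gamma_ext : extended_log_gauss_map gamma)
    (y : @proj_space R n) :
  finite_set (gamma @^-1` [set y]).
Proof.
have [[p0 _]|empty] := pselect (exists p, gamma p = y); last first.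
  apply: (@finite_set_injF _ unit _ (fun=> tt)) => p q py.
  by case: empty; exists p.
have P0 : msupp P != [::] := cone_point_nonempty (repr (set_val p0)).
pose y0 := proj_coord y.
have rep p : exists x : cone_points (newton_polytope P), gamma p = y ->
    [/\ to_Tor x = set_val p, equation_section P (set_val x) = 0
      & gradient_section P (set_val x) = y0].
  have [py|npy] := pselect (gamma p = y); last by exists (repr (set_val p)).
  have cp : closure_in_Tor P (to_Tor (repr (set_val p))).
    by rewrite repr_Tor; exact: set_mem (valP p).
  have [k kE] := log_gauss_map_closure gamma_ext P_nonsingular p.
  have k0 : k != 0.
    apply: contraNneq (gradient_neq0 P_nonsingular cp) => k0.
    by rewrite -[set_val _]/(Tor_coord (set_val p)) kE k0 scale0r.
  have kV0 : k^-1 != 0 by rewrite invr_eq0.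
  have [x [xE xT]] := scale_cone_point (repr (set_val p)) kV0.
  exists x => _.
  have {}xE : set_val x = scale_cone k^-1 (Tor_coord (set_val p)) by exact/funext.
  split; first by rewrite xT repr_Tor.
  - rewrite xE equation_scale equation_of_closure ?mulr0 //.
    exact: set_mem (valP p).
  - by rewrite xE gradient_scale kE scalerA mulVf // scale1r py.
have /boolp.choice[x xP] := rep.
have [K [b [bS bP]]] := gordan P.
have bS1 i : cone_semigroup (newton_polytope P) (b i) by case: (bS i).
have bS2 i : (0 < (b i).1)%N by case: (bS i).
have /boolp.choice[al alP] s : exists a : multinom K,
    cone_semigroup (newton_polytope P) s -> s = \sum_i b i *+ a i.
  have [/bP[a aE]|nSs] := pselect (cone_semigroup (newton_polytope P) s).
    exists (Multinom [tuple a i | i < K]) => _.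
    by rewrite {1}aE; apply: eq_bigr => i _; rewrite mnmE.
  by exists mnm0.
have [k [M bounded]] := fiber_system_bounded bS1 bS2 P0 alP P_nonsingular y0.
have [s sP] := bounded_algebraic_set_finite bounded.
have xs p i : gamma p = y -> set_val (x p) (b i) \in s.
  move=> /xP[_ Fx Gx].
  have xal t : cone_semigroup (newton_polytope P) t ->
      meval (fun i => set_val (x p) (b i)) (mpolyX _ (al t)) = set_val (x p) t.
    by move=> St; exact: cone_point_meval.
  apply: (sP (fun i => set_val (x p) (b i))) => q.
  rewrite inE mem_cat => /predU1P[->|/orP[/mapP[j _ ->]|/mapP[j _ ->]]].
  - by rewrite (meval_equation_poly xal).
  - by rewrite mevalB mevalC (meval_gradient_poly j xal) Gx subrr.
  - exact: cone_point_relation.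
apply: (@finite_set_injF _ _ _
  (fun p => [ffun i => inord (index (set_val (x p) (b i)) s) : 'I_(size s).+1])).
move=> p q py qy pq; apply: val_inj.
have [xp _ _] := xP p py; have [xq _ _] := xP q qy.
have : to_Tor (x p) = to_Tor (x q); last by rewrite xp xq.
apply: (cone_point_gen_inj bS1 bP) => i.
have /(congr1 val) := congr1 (fun f : {ffun _} => f i) pq; rewrite !ffunE /=.
rewrite !inordK ?ltnS ?index_size // => E.
by rewrite -(nth_index 0 (xs p i py)) E nth_index // xs.
Qed.
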